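(* For any consistent intermediate propositional logic $L$, the following are equivalent: (1) $L$ has the Craig interpolation property; (2) $L$ has the uniform interpolation property; (3) $L$ has the Lyndon interpolation property; (4) $L$ has the uniform Lyndon interpolation property.
   Context: Propositional formulas are built from variables, $\bot$, $\land,\lor,\neg,\to$. An intermediate propositional logic is a set of formulas containing intuitionistic propositional logic $\mathbf{Int}$, contained in classical logic, closed under modus ponens and uniform substitution; it is consistent if it does not contain $\bot$. $v(\varphi)$ is the set of variables of $\varphi$; $v^+(\varphi),v^-(\varphi)$: $v^+(p)=\{p\}$, $v^-(p)=\emptyset$, $v^\circ(\bot)=\emptyset$, $v^\circ(\varphi\ast\psi)=v^\circ(\varphi)\cup v^\circ(\psi)$ for $\ast\in\{\land,\lor\}$, $v^\pm(\neg\varphi)=v^\mp(\varphi)$, $v^+(\varphi\to\psi)=v^-(\varphi)\cup v^+(\psi)$, $v^-(\varphi\to\psi)=v^+(\varphi)\cup v^-(\psi)$. CIP: if $L\vdash\varphi\to\psi$ then there is $\rho$ with $v(\rho)\subseteq v(\varphi)\cap v(\psi)$, $L\vdash\varphi\to\rho$, $L\vdash\rho\to\psi$. LIP: same with $v^\circ(\rho)\subseteq v^\circ(\varphi)\cap v^\circ(\psi)$ for $\circ\in\{+,-\}$. UIP: for every $\varphi$ and finite set $P$ of variables there is $\theta$ with $L\vdash\varphi\to\theta$, $v(\theta)\subseteq v(\varphi)\setminus P$, and $L\vdash\theta\to\psi$ for every $\psi$ with $L\vdash\varphi\to\psi$ and $v(\psi)\cap P=\emptyset$. ULIP: for every $\varphi$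 and finite sets $P^+,P^-$ there is $\theta$ with $L\vdash\varphi\to\theta$, $v^\circ(\theta)\subseteq v^\circ(\varphi)\setminus P^\circ$ for $\circ\in\{+,-\}$, and $L\vdash\theta\to\psi$ for every $\psi$ with $L\vdash\varphi\to\psi$ and $v^\circ(\psi)\cap P^\circ=\emptyset$ for $\circ\in\{+,-\}$. *)

(* Defs.v *)
From mathcomp Require Import all_boot.
From mathcomp Require Import finmap.

Set Implicit Arguments.
Unset Strict Implicit.
Unset Printing Implicit Defensive.

Local Open Scope fset_scope.

Definition var := nat.

Inductive form : Type :=
| Var of var
| Bot
| And of form & form
| Or of form & form
| Neg of form
| Imp of form & form.

Declare Scope form_scope.
Delimit Scope form_scope with F.
Bind Scope form_scope with form.
Notation "A ~> B" := (Imp A B)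
  (at level 60, right associativity) : form_scope.
Local Open Scope form_scope.

Fixpoint subst (s : var -> form) (A : form) : form :=
  match A with
  | Var p => s p
  | Bot => Bot
  | And A B => And (subst s A) (subst s B)
  | Or A B => Or (subst s A) (subst s B)
  | Neg A => Neg (subst s A)
  | Imp A B => subst s A ~> subst s B
  end.

Inductive Int : form -> Prop :=
| Int_K A B : Int (A ~> B ~> A)
| Int_S A B C : Int ((A ~> B ~> C) ~> (A ~> B) ~> A ~> C)
| Int_andl A B : Int (And A B ~> A)
| Int_andr A B : Int (And A B ~> B)
| Int_andI A B : Int (A ~> B ~> And A B)
| Int_orl A B : Int (A ~> Or A B)
| Int_orr A B : Int (B ~> Or A B)
| Int_orE A B C : Int ((A ~> C) ~> (B ~> C) ~> Or A B ~> C)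
| Int_bot A : Int (Bot ~> A)
| Int_negE A : Int (Neg A ~> A ~> Bot)
| Int_negI A : Int ((A ~> Bot) ~> Neg A)
| Int_mp A B : Int (A ~> B) -> Int A -> Int B.

Fixpoint eval (e : var -> bool) (A : form) : bool :=
  match A with
  | Var p => e p
  | Bot => false
  | And A B => eval e A && eval e B
  | Or A B => eval e A || eval e B
  | Neg A => ~~ eval e A
  | Imp A B => eval e A ==> eval e B
  end.

Definition Cl (A : form) : Prop := forall e, eval e A.

(* A logic is identified with its set of theorems: [L A] reads "L proves A". *)
Record intermediate_logic (L : form -> Prop) : Prop := IntermediateLogic {
  logic_Int : forall A, Int A -> L A;
  logic_Cl : forall A, L A -> Cl A;
  logic_mp : forall A B, L (A ~> B) -> L A -> L B;
  logic_subst : forall s A, L A -> L (subst s A)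
}.

Definition consistent (L : form -> Prop) : Prop := ~ L Bot.

Fixpoint vars (A : form) : {fset var} :=
  match A with
  | Var p => [fset p]
  | Bot => fset0
  | Neg A => vars A
  | And A B | Or A B | Imp A B => vars A `|` vars B
  end.

(* [svars true] is v^+ and [svars false] is v^-. *)
Fixpoint svars (o : bool) (A : form) : {fset var} :=
  match A with
  | Var p => if o then [fset p] else fset0
  | Bot => fset0
  | And A B | Or A B => svars o A `|` svars o B
  | Neg A => svars (~~ o) A
  | Imp A B => svars (~~ o) A `|` svars o B
  end.

Definition CIP (L : form -> Prop) : Prop :=
  forall A B, L (A ~> B) ->
  exists C, [/\ vars C `<=` vars A `&` vars B, L (A ~> C) & L (C ~> B)].

Definition LIP (L : form -> Prop) : Prop :=
  forall A B, L (A ~> B) ->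
  exists C, [/\ forall o, svars o C `<=` svars o A `&` svars o B,
                L (A ~> C) & L (C ~> B)].

Definition UIP (L : form -> Prop) : Prop :=
  forall (A : form) (P : {fset var}),
  exists C, [/\ L (A ~> C), vars C `<=` vars A `\` P
              & forall B, L (A ~> B) -> vars B `&` P = fset0 -> L (C ~> B)].

(* [P true] and [P false] are the finite sets P^+ and P^-. *)
Definition ULIP (L : form -> Prop) : Prop :=
  forall (A : form) (P : bool -> {fset var}),
  exists C, [/\ L (A ~> C), forall o, svars o C `<=` svars o A `\` P o
              & forall B, L (A ~> B) ->
                (forall o, svars o B `&` P o = fset0) -> L (C ~> B)].

(* Main.v *)
(** CIP amounts to amalgamation of frames: if finite rooted frames F1 and F2 of L map
    p-morphically onto F0, some cone of the canonical model of L maps onto both over F0.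
    Amalgamating well-chosen small frames shows that L is determined by very few of them
    (Maksimova's classification). If the three-element chain is not a frame of L, then L has
    depth at most two and its frames are forks with at most 0, 1, 2 or arbitrarily many leaves;
    if it is one, then so are all finite trees when the fork is a frame of L, all finite trees
    with a top added when only the diamond is, and all finite chains, with L linear, otherwise.
    In each case a uniform Lyndon interpolant of A is the conjunction of its consequences of
    bounded implication depth in the allowed signed vocabulary: given a world x of A that
    simulates, up to that depth, a world y refuting B, a common model of A and not B is
    assembled from pairs of worlds above x and y. For trees the depth has to grow with the
    number of subformulas of A, as in Visser's proof of Pitts' theorem. *)

From HB Require Import structures.
Require Import Defs.
From mathcomp Require Import all_boot finmap.
From mathcomp Require Import boolp classical_sets.
From mathcomp Require Import zify.

Set Implicit Arguments.
Unset Strict Implicit.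
Unset Printing Implicit Defensive.

Local Open Scope form_scope.

(** The canonical frame of [L] is not known to validate [L], so it cannot itself be the amalgam. It
    only serves as a source of p-morphisms: sets pulled back from a finite frame are defined by
    formulas, and closure under substitution then carries validity to the finite image.
    Interpolation is used at a single place, to show that the diagrams of two rooted frames over a
    common image are jointly consistent; what follows is combinatorics of frames. The models
    refuting [A ~> B] are glued from worlds, hence possibly infinite and only preordered. That their
    frames validate [L] is recovered formula by formula, by comparison with finite frames already
    obtained. Signs cost nothing at this stage: the glued valuation makes true just what positive
    occurrences in [A] and negative ones in [B] require, so a simulation that respects atoms in one
    direction per sign is enough. *)

HB.instance Definition _ := gen_eqMixin form.

(** * Kripke semantics *)

Section Kripke.
Variables (W : Type) (le : W -> W -> Prop) (V : var -> W -> Prop).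

Fixpoint forces (w : W) (A : form) : Prop :=
  match A with
  | Var p => V p w
  | Bot => False
  | And A B => forces w A /\ forces w B
  | Or A B => forces w A \/ forces w B
  | Neg A => forall u, le w u -> ~ forces u A
  | Imp A B => forall u, le w u -> forces u A -> forces u B
  end.

Definition upward (vs : var -> Prop) :=
  forall p w u, vs p -> le w u -> V p w -> V p u.

Hypothesis le_trans : forall u v w, le u v -> le v w -> le u w.

Lemma forces_le A w u : upward (fun p => p \in vars A) ->
  le w u -> forces w A -> forces u A.
Proof.
elim: A w u => [p|//|A IA B IB|A IA B IB|A IA|A IA B IB] w u /= hV lwu.
- by apply: hV lwu; rewrite inE.
- case=> ha hb; split; [apply: IA lwu ha | apply: IB lwu hb] => p ? ? hp;
    by apply: hV; rewrite inE hp ?orbT.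
- case=> [ha|hb]; [left; apply: IA lwu ha | right; apply: IB lwu hb] => p ? ? hp;
    by apply: hV; rewrite inE hp ?orbT.
- by move=> hn v luv; apply: hn; apply: le_trans luv.
- by move=> hi v luv; apply: hi; apply: le_trans luv.
Qed.

End Kripke.

(* [R true p]: p passes from K to Z along E; [R false p]: from Z to K. Formulas whose
   signed variables obey R (flipped when [o] is false) transfer accordingly. *)
Lemma signed_bisim (Z K : Type) (leZ : Z -> Z -> Prop) (leK : K -> K -> Prop)
    (VZ : var -> Z -> Prop) (VK : var -> K -> Prop)
    (E : Z -> K -> Prop) (R : bool -> var -> Prop) :
  (forall z k z', E z k -> leZ z z' -> exists2 k', leK k k' & E z' k') ->
  (forall z k k', E z k -> leK k k' -> exists2 z', leZ z z' & E z' k') ->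
  (forall p z k, E z k -> R true p -> VK p k -> VZ p z) ->
  (forall p z k, E z k -> R false p -> VZ p z -> VK p k) ->
  forall C (o : bool) z k,
    (forall o' p, p \in svars o' C -> R (o' == o) p) -> E z k ->
    if o then forces leK VK k C -> forces leZ VZ z C
    else forces leZ VZ z C -> forces leK VK k C.
Proof.
move=> forth back Rt Rf; elim=> [p|//|A IA B IB|A IA B IB|A IA|A IA B IB] o z k /= hR hE.
- have := hR true p; rewrite inE eqxx => /(_ isT).
  by case: o {hR} => h; [apply: Rt | apply: Rf].
- by case: (o).
- have hA o' p : p \in svars o' A -> R (o' == o) p by move=> hp; apply: hR; rewrite inE hp.
  have hB o' p : p \in svars o' B -> R (o' == o) p.
    by move=> hp; apply: hR; rewrite inE hp orbT.
  by move: (IA _ _ _ hA hE) (IB _ _ _ hB hE); case: (o) => a b [ha hb]; split; auto.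
- have hA o' p : p \in svars o' A -> R (o' == o) p by move=> hp; apply: hR; rewrite inE hp.
  have hB o' p : p \in svars o' B -> R (o' == o) p.
    by move=> hp; apply: hR; rewrite inE hp orbT.
  by move: (IA _ _ _ hA hE) (IB _ _ _ hB hE); case: (o) => a b [h|h]; auto.
- have hA o' p : p \in svars o' A -> R (o' == ~~ o) p.
    by move=> hp; have := hR (~~ o') p; rewrite negbK -eqb_negLR; apply.
  case: o {hR} hA => hA h.
  + move=> u /(forth _ _ _ hE) [k' lk hE'] /(IA false _ _ hA hE'); exact: h.
  + move=> u /(back _ _ _ hE) [z' lz hE'] /(IA true _ _ hA hE'); exact: h.
- have hA o' p : p \in svars o' A -> R (o' == ~~ o) p.
    by move=> hp; have := hR (~~ o') p; rewrite negbK -eqb_negLR inE hp; apply.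
  have hB o' p : p \in svars o' B -> R (o' == o) p.
    by move=> hp; apply: hR; rewrite inE hp orbT.
  case: o {hR} hA hB => hA hB h.
  + move=> u /(forth _ _ _ hE) [k' lk hE'] /(IA false _ _ hA hE') ha.
    by apply: (IB true _ _ hB hE'); apply: h.
  + move=> u /(back _ _ _ hE) [z' lz hE'] /(IA true _ _ hA hE') ha.
    by apply: (IB false _ _ hB hE'); apply: h.
Qed.

Lemma svars_vars o A p : p \in svars o A -> p \in vars A.
Proof.
elim: A o => [q|//|A IA B IB|A IA B IB|A IA|A IA B IB] o /=.
- by case: (o).
- by rewrite !inE => /orP[/IA|/IB] ->; rewrite ?orbT.
- by rewrite !inE => /orP[/IA|/IB] ->; rewrite ?orbT.
- exact: IA.
- by rewrite !inE => /orP[/IA|/IB] ->; rewrite ?orbT.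
Qed.

Lemma vars_svars A p : p \in vars A -> exists o, p \in svars o A.
Proof.
elim: A => [q|//|A IA B IB|A IA B IB|A IA|A IA B IB] /=.
- by exists true.
- by rewrite inE => /orP[/IA|/IB] [o h]; exists o; rewrite inE h ?orbT.
- by rewrite inE => /orP[/IA|/IB] [o h]; exists o; rewrite inE h ?orbT.
- by move=> /IA [o h]; exists (~~ o); rewrite negbK.
- rewrite inE => /orP[/IA|/IB] [o h]; [exists (~~ o) | exists o];
  by rewrite inE ?negbK h ?orbT.
Qed.

Lemma forces_bisim (Z K : Type) (leZ : Z -> Z -> Prop) (leK : K -> K -> Prop)
    (VZ : var -> Z -> Prop) (VK : var -> K -> Prop) (E : Z -> K -> Prop) A :
  (forall z k z', E z k -> leZ z z' -> exists2 k', leK k k' & E z' k') ->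
  (forall z k k', E z k -> leK k k' -> exists2 z', leZ z z' & E z' k') ->
  (forall p z k, p \in vars A -> E z k -> VZ p z <-> VK p k) ->
  forall z k, E z k -> forces leZ VZ z A <-> forces leK VK k A.
Proof.
move=> forth back hV z k hE; pose R (o : bool) p := is_true (p \in vars A).
have Rt p z' k' : E z' k' -> R true p -> VK p k' -> VZ p z'.
  by move=> e r; move/(hV _ _ _ r e).
have Rf p z' k' : E z' k' -> R false p -> VZ p z' -> VK p k'.
  by move=> e r; move/(hV _ _ _ r e).
have hR o o' p : p \in svars o' A -> R (o' == o) p := @svars_vars o' A p.
split; [apply: (signed_bisim forth back Rt Rf (o := false) (hR false) hE)
       |apply: (signed_bisim forth back Rt Rf (o := true) (hR true) hE)].
Qed.

Lemma forces_map (Y Z : Type) (leY : Y -> Y -> Prop) (leZ : Z -> Z -> Prop)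
    (VY : var -> Y -> Prop) (VZ : var -> Z -> Prop) (f : Y -> Z) A :
  (forall y y', leY y y' -> leZ (f y) (f y')) ->
  (forall y z, leZ (f y) z -> exists2 y', leY y y' & f y' = z) ->
  (forall p y, p \in vars A -> VY p y <-> VZ p (f y)) ->
  forall y, forces leY VY y A <-> forces leZ VZ (f y) A.
Proof.
move=> mono back hV y; apply: (forces_bisim (E := fun y z => f y = z)) => //.
- by move=> y1 _ y' <- l; exists (f y') => //; apply: mono.
- by move=> y1 _ z <- l; apply: back.
- by move=> p y1 _ hp <-; apply: hV.
Qed.

Definition bigand (s : seq form) := foldr And (Neg Bot) s.
Definition bigor (s : seq form) := foldr Or Bot s.

Lemma forces_bigand W le V (w : W) s :
  forces le V w (bigand s) <-> (forall C, C \in s -> forces le V w C).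
Proof.
elim: s => [|C s IH]; first by split=> //= _ u _.
rewrite /= IH; split=> [[hC hs] D|h].
  by rewrite inE => /orP[/eqP ->|/hs].
by split=> [|D hD]; apply: h; rewrite inE ?eqxx ?hD ?orbT.
Qed.

Lemma forces_bigor W le V (w : W) s :
  forces le V w (bigor s) <-> (exists2 C, C \in s & forces le V w C).
Proof.
elim: s => [|C s IH] /=; first by split=> // -[].
rewrite IH; split=> [[h|[D hD h]]|[D]]; first by exists C; rewrite ?inE ?eqxx.
  by exists D; rewrite // inE hD orbT.
by rewrite inE => /orP[/eqP ->|hD] h; [left|right; exists D].
Qed.

(** * The canonical model of a logic *)

Section Canonical.
Variable L : form -> Prop.
Hypothesis hL : intermediate_logic L.

Definition valid (W : Type) (le : W -> W -> Prop) :=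
  forall A, L A -> forall V, upward le V (fun _ => True) -> forall w, forces le V w A.

(** Substitution is not a rule: it applies to theorems of [L], not to the hypotheses in [G]. This is
    what keeps the deduction theorem valid. *)
Inductive ded (G : form -> Prop) : form -> Prop :=
| ded_ax A : G A -> ded G A
| ded_logic A : L A -> ded G A
| ded_mp A B : ded G (A ~> B) -> ded G A -> ded G B.

Let LI A (h : Int A) : L A := logic_Int hL h.

Lemma ded_weaken G G' A : (forall B, G B -> G' B) -> ded G A -> ded G' A.
Proof.
move=> s; elim=> [B /s|B|B C _ h1 _ h2]; [exact: ded_ax|exact: ded_logic|exact: ded_mp h1 h2].
Qed.

Lemma ded_intro (G : form -> Prop) A B : ded (fun C => G C \/ C = A) B -> ded G (A ~> B).
Proof.
elim=> [C [h|->]|C h|C D _ h1 _ h2].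
- by apply: ded_mp (ded_ax h); apply/ded_logic/LI/Int_K.
- have S := Int_S A (A ~> A) A; apply/ded_logic/LI.
  apply: (Int_mp (Int_mp S (Int_K _ _))); exact: Int_K.
- by apply: ded_mp (ded_logic _ h); apply/ded_logic/LI/Int_K.
- apply: ded_mp h2; apply: ded_mp h1; exact/ded_logic/LI/Int_S.
Qed.

Record prime_theory (w : form -> Prop) : Prop := Prime {
  prime_logic : forall A, L A -> w A;
  prime_mp : forall A B, w (A ~> B) -> w A -> w B;
  prime_bot : ~ w Bot;
  prime_or : forall A B, w (Or A B) -> w A \/ w B }.

Record world := World { mem_world :> form -> Prop; worldP : prime_theory mem_world }.

Definition wle (w u : world) := forall A, w A -> u A.

Lemma wle_refl w : wle w w. Proof. by []. Qed.
Lemma wle_trans u v w : wle u v -> wle v w -> wle u w.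
Proof. by move=> h1 h2 A /h1 /h2. Qed.

(** Zorn gives a maximal [M] that does not help [G] to derive [A]. By maximality every formula
    outside the deductive closure implies [A] over it, and this makes the closure prime. *)
Lemma lindenbaum G A : ~ ded G A -> exists2 w : world, (forall B, G B -> w B) & ~ w A.
Proof.
move=> hA.
pose P := (fun X : set form => ~ ded (fun C => G C \/ X C) A) : set (set form).
have [|M [PM maxM]] := @Zorn_bigcup _ P.
  (* A derivation is finite and the family is a chain, so one member contains all hypotheses used.
     The left disjunct covers derivations from [G] alone, which exist even for the empty family. *)
  move=> F FP tot hd; have key C : ded (fun C => G C \/ (\bigcup_(X in F) X)%classic C) C ->
      ded G C \/ exists2 X, F X & ded (fun C => G C \/ X C) C.
    elim=> {C} [C [h|[X FX XC]]|C h|C D _ h1 _ h2].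
    - by left; apply: ded_ax.
    - by right; exists X => //; apply: ded_ax; right.
    - by left; apply: ded_logic.
    - have w X E : ded G E -> ded (fun C => G C \/ X C) E by apply: ded_weaken; left.
      case: h1 => [h1|[X FX h1]]; case: h2 => [h2|[Y FY h2]].
      + by left; apply: ded_mp h1 h2.
      + by right; exists Y => //; apply: ded_mp h2; apply: w.
      + by right; exists X => //; apply: ded_mp h1 _; apply: w.
      + have [XY|YX] := tot _ _ FX FY.
        * right; exists Y => //; apply: ded_mp h2; apply: ded_weaken h1.
          by move=> B [|/XY]; [left|right].
        * right; exists X => //; apply: ded_mp h1 _; apply: ded_weaken h2.
          by move=> B [|/YX]; [left|right].
  by case: (key _ hd) => [//|[X /FP]].
pose w C := ded (fun C => G C \/ M C) C.
have ext C : ~ w C -> w (C ~> A).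
  move=> nC; apply: ded_intro; apply: contrapT => nd.
  have MC : ~ M C by move=> h; apply: nC; apply: ded_ax; right.
  apply: (maxM (fun D => M D \/ D = C)).
    by split=> [D|/(_ C)]; [left|move=> /(_ (or_intror erefl))].
  by move=> h; apply: nd; apply: ded_weaken h => B [?|[?|?]]; tauto.
suff pw : prime_theory w.
  by exists (World pw) => // B h; apply: ded_ax; left.
split=> [B|B C| |B C hor].
- exact: ded_logic.
- exact: ded_mp.
- by move=> hb; apply: PM; apply: ded_mp hb; apply/ded_logic/LI/Int_bot.
- apply: contrapT => /not_orP[/ext hB /ext hC]; apply: PM.
  apply: ded_mp hor; apply: ded_mp hC; apply: ded_mp hB.
  exact/ded_logic/LI/Int_orE.
Qed.

Lemma w_logic (w : world) A : L A -> w A. Proof. exact: (prime_logic (worldP w)). Qed.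
Lemma w_mp (w : world) A B : w (A ~> B) -> w A -> w B.
Proof. exact: (prime_mp (worldP w)). Qed.
Lemma w_bot (w : world) : ~ w Bot. Proof. exact: (prime_bot (worldP w)). Qed.

Lemma w_and (w : world) A B : w (And A B) <-> w A /\ w B.
Proof.
split=> [h|[hA hB]].
  by split; apply: w_mp h; apply/w_logic/LI; [apply: Int_andl|apply: Int_andr].
by apply: w_mp hB; apply: w_mp hA; apply/w_logic/LI/Int_andI.
Qed.

Lemma w_or (w : world) A B : w (Or A B) <-> w A \/ w B.
Proof.
split; first exact: (prime_or (worldP w)).
by case; apply: w_mp; apply/w_logic/LI; [apply: Int_orl|apply: Int_orr].
Qed.

Lemma w_imp (w : world) A B : w (A ~> B) <-> (forall u, wle w u -> u A -> u B).
Proof.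
split=> [h u lu|h]; first exact: w_mp (lu _ h).
apply: contrapT => nh; have [|u hu nB] := @lindenbaum (fun C => w C \/ C = A) B.
  move=> /ded_intro hd; apply: nh; elim: hd => [//|C|C D _ h1 _ h2].
    exact: w_logic.
  exact: w_mp h1 h2.
by apply: nB; apply: h => [C hC|]; apply: hu; tauto.
Qed.

Lemma w_neg (w : world) A : w (Neg A) <-> (forall u, wle w u -> ~ u A).
Proof.
split=> [h u lu hA|h].
  apply: (@w_bot u); apply: w_mp hA; apply: w_mp (lu _ h); exact/w_logic/LI/Int_negE.
apply: (@w_mp w (A ~> Bot)); first exact/w_logic/LI/Int_negI.
by apply/w_imp => u lu /(h _ lu).
Qed.

Lemma logicP A : L A <-> (forall w : world, w A).
Proof.
split=> [h w|h]; first exact: w_logic.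
apply: contrapT => nA; have [|w _ nw] := @lindenbaum (fun _ => False) A; last exact/nw/h.
move=> hd; apply: nA; elim: hd => [//|//|B C _ h1 _ h2]; exact: (logic_mp hL h1 h2).
Qed.

Lemma logic_impP A B : L (A ~> B) <-> (forall w : world, w A -> w B).
Proof.
rewrite logicP; split=> [h w|h w]; first by move/w_imp: (h w); apply.
by apply/w_imp => u _; apply: h.
Qed.

Definition canV (p : var) (w : world) := w (Var p).

Lemma forces_can A (w : world) : forces wle canV w A <-> w A.
Proof.
elim: A w => [p|//|A IA B IB|A IA B IB|A IA|A IA B IB] w /=.
- by [].
- by split=> // /w_bot.
- by rewrite w_and IA IB.
- by rewrite w_or IA IB.
- by rewrite w_neg; split=> h u /h; rewrite IA.
- by rewrite w_imp; split=> h u /h; rewrite IA IB.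
Qed.

Lemma w_bigand (w : world) s : w (bigand s) <-> (forall C, C \in s -> w C).
Proof.
by rewrite -forces_can forces_bigand; split=> h C /h; rewrite forces_can.
Qed.

Lemma w_bigor (w : world) s : w (bigor s) <-> (exists2 C, C \in s & w C).
Proof.
rewrite -forces_can forces_bigor; split=> -[C hC];
by [rewrite forces_can; exists C|exists C => //; apply/forces_can].
Qed.

(* The canonical frame need not validate L, but valuations by definable sets do. *)
Lemma valid_definable (Y : Type) (leY : Y -> Y -> Prop) (w0 : world) (k : world -> Y) :
  (forall u v, wle w0 u -> wle u v -> leY (k u) (k v)) ->
  (forall u z, wle w0 u -> leY (k u) z -> exists2 v, wle u v & k v = z) ->
  (forall S : Y -> Prop, (forall y z, leY y z -> S y -> S z) ->
     exists phi, forall u, wle w0 u -> u phi <-> S (k u)) ->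
  (forall z, leY (k w0) z) -> valid leY.
Proof.
move=> mono back def root A hA V hV z.
(* Each variable is replaced by the formula that defines its truth set; [subst s A] is a theorem,
   and [key] reads its membership in a world as truth of [A] at the image. *)
have [s hs] : {s : var -> form & forall p u, wle w0 u -> u (s p) <-> V p (k u)}.
  apply: (@choice _ _ (fun p phi => forall u, wle w0 u -> u phi <-> V p (k u))) => p.
  by apply: def => y z0; apply: hV.
have key B : forall u, wle w0 u -> u (subst s B) <-> forces leY V (k u) B.
  elim: B => [p|//|B IB C IC|B IB C IC|B IB|B IB C IC] u hu /=.
  - exact: hs.
  - by split=> // /w_bot.
  - by rewrite w_and IB // IC.
  - by rewrite w_or IB // IC.
  - rewrite w_neg; split=> h v.
    + move=> /(back _ _ hu) [u' lu <-]; rewrite -IB; [exact: h|exact: wle_trans lu].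
    + move=> lv; rewrite IB; [apply: h; exact: mono|exact: wle_trans lv].
  - rewrite w_imp; split=> h v.
    + move=> /(back _ _ hu) [u' lu <-].
      by rewrite -IB -?IC; [exact: h|exact: wle_trans lu|exact: wle_trans lu].
    + move=> lv; rewrite IB ?IC; [apply: h; exact: mono|exact: wle_trans lv..].
have [v lv <-] := back _ _ (@wle_refl w0) (root z).
apply/key => //; apply: w_logic; exact: (logic_subst hL).
Qed.

End Canonical.

Lemma valid_pmorph L (Y Z : Type) (leY : Y -> Y -> Prop) (leZ : Z -> Z -> Prop) (f : Y -> Z) :
  (forall y y', leY y y' -> leZ (f y) (f y')) ->
  (forall y z, leZ (f y) z -> exists2 y', leY y y' & f y' = z) ->
  (forall z, exists y, f y = z) -> valid L leY -> valid L leZ.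
Proof.
move=> mono back surj hv A hA V hV z; have [y <-] := surj z.
apply/(@forces_map _ _ leY leZ (fun p y => V p (f y)) V f) => //.
by apply: hv => // p y1 y2 _ /mono; apply: hV.
Qed.

(** * Finite frames and their amalgamation *)

Record frame := Frame {
  pt :> finType;
  fle : rel pt;
  fle_refl : reflexive fle;
  fle_trans : transitive fle;
  fle_anti : antisymmetric fle }.

Definition fvalid (L : form -> Prop) (F : frame) := valid L (fun x y : F => fle x y).

Definition pmorph (X Y : frame) (f : X -> Y) :=
  (forall x x', fle x x' -> fle (f x) (f x')) /\
  (forall x y, fle (f x) y -> exists2 x', fle x x' & f x' = y).

Lemma vars_bigor s p : p \in vars (bigor s) -> exists2 C, C \in s & p \in vars C.
Proof.
elim: s => [//|C s IH] /=; rewrite in_fsetU => /orP[h|/IH [D hD h]].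
  by exists C; rewrite ?mem_head.
by exists D; rewrite // inE hD orbT.
Qed.

(** * Reading a finite frame off a world that contains its diagram *)

Section Side.
Variables (L : form -> Prop) (hL : intermediate_logic L).
Variables (F F0 : frame) (f : F -> F0) (r : F) (V : var -> F -> Prop).
Variables (c0 : {set F0} -> var) (c1 : {set F} -> var) (cls : var -> Prop).
Hypothesis f_mono : forall x x', fle x x' -> fle (f x) (f x').
Hypothesis V0 : forall S x, V (c0 S) x <-> (forall y, fle x y -> f y \in S).
Hypothesis V1 : forall S x, V (c1 S) x <-> (forall y, fle x y -> y \in S).
Hypothesis cls0 : forall S, cls (c0 S).
Hypothesis cls1 : forall S, cls (c1 S).
Variable w : world L.
Hypothesis hw : forall C, (forall p, p \in vars C -> cls p) ->
  forces (fun x y : F => fle x y) V r C -> w C.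
Hypothesis hr : forall x, fle r x.

Let up (x : F) := [set y | fle x y].
(** The largest upset that omits [x]: an upset either contains [up x] or is contained in [nd x].
    Having [up x] without [nd x] therefore pins down the point [x]. *)
Let nd (x : F) := [set y | ~~ fle y x].

Let fact u C : wle w u -> (forall p, p \in vars C -> cls p) ->
  (forall x, forces (fun x y : F => fle x y) V x C) -> u C.
Proof. by move=> lu hC hf; apply: lu; apply: hw. Qed.

(** The upsets whose variables belong to [u] form a prime filter in a finite lattice, and such a
    filter is generated by one cone [up x]. *)
Let up_point (u : world L) : wle w u -> exists x : F,
  forall S : {set F}, (forall y z, fle y z -> y \in S -> z \in S) -> u (Var (c1 S)) <-> x \in S.
Proof.
move=> lu.
have mon (S S' : {set F}) : {subset S <= S'} -> u (Var (c1 S)) -> u (Var (c1 S')).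
  move=> sS; apply: (w_mp (A := Var (c1 S))); apply: fact => //= [p|x y _].
    by rewrite !inE => /orP[] /eqP ->.
  by rewrite !V1 => h z /h /sS.
have hr0 : `[< u (Var (c1 (up r))) >].
  apply/asboolP; apply: fact => //= [p|x]; first by rewrite inE => /eqP ->.
  by rewrite V1 => y _; rewrite inE.
have [x0 /asboolP ux0 minx] := @arg_minnP _ r (fun x => `[< u (Var (c1 (up x))) >]) (fun x => #|up x|) hr0.
have nux : ~ u (Var (c1 (nd x0))).
  move=> und.
  (* The intersection of [up x0] and [nd x0] is the union of the cones strictly inside [up x0];
     primeness of [u] selects one of them, against minimality. *)
  have : u (bigor [seq Var (c1 (up y)) | y <- enum [pred y | fle x0 y && ~~ fle y x0]]).
    apply: (w_mp (A := And (Var (c1 (up x0))) (Var (c1 (nd x0))))); last exact/w_and.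
    apply: fact => //= [p|x1 y _ [/V1 h1 /V1 h2]].
      rewrite !inE -orbA => /or3P[/eqP ->|/eqP ->|/vars_bigor [C /mapP [z _ ->]]] //.
      by rewrite inE => /eqP ->.
    apply/forces_bigor; exists (Var (c1 (up y))).
      have := h1 y (fle_refl y); have := h2 y (fle_refl y); rewrite !inE => a b.
      by apply/mapP; exists y; rewrite // mem_enum inE a b.
    by apply/V1 => z; rewrite inE.
  move/(w_bigor hL) => [C /mapP [y]]; rewrite mem_enum inE => /andP[xy nyx] ->.
  move/asboolP/minx; apply/negP; rewrite -ltnNge; apply/proper_card/properP.
  split; first by apply/fintype.subsetP=> z; rewrite !inE; apply: fle_trans.
  by exists x0; rewrite !inE ?fle_refl.
exists x0 => S upS; split=> [uS|xS].
  apply: contrapT => nxS; apply: nux; apply: mon uS => y yS; rewrite inE.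
  by apply/negP => yx; apply: nxS; apply: upS yS.
by apply: mon ux0 => y; rewrite inE => xy; apply: upS xS.
Qed.

Lemma side_map : exists g : world L -> F,
  [/\ forall u v, wle w u -> wle u v -> fle (g u) (g v),
      forall u x, wle w u -> fle (g u) x -> exists2 v, wle u v & g v = x,
      forall S : {set F}, (forall y z, fle y z -> y \in S -> z \in S) ->
        forall u, wle w u -> u (Var (c1 S)) <-> g u \in S
    & forall S : {set F0}, (forall y z, fle y z -> y \in S -> z \in S) ->
        forall u, wle w u -> u (Var (c0 S)) <-> f (g u) \in S].
Proof.
have [g hg] : {g : world L -> F & forall u, wle w u -> forall S : {set F},
    (forall y z, fle y z -> y \in S -> z \in S) -> u (Var (c1 S)) <-> g u \in S}.
  apply: (@choice _ _ (fun (u : world L) x => wle w u -> forall S : {set F},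
    (forall y z, fle y z -> y \in S -> z \in S) -> u (Var (c1 S)) <-> x \in S)) => u.
  have [/up_point [x hx]|h] := pselect (wle w u); first by exists x.
  by exists r => /h.
have up_up x y z : fle y z -> y \in up x -> z \in up x.
  by rewrite !inE => yz xy; apply: fle_trans yz.
have nd_up x y z : fle y z -> y \in nd x -> z \in nd x.
  by rewrite !inE => yz; apply: contra; apply: fle_trans.
exists g; split.
- move=> u v wu uv; suff : g v \in up (g u) by rewrite inE.
  apply/(hg v); [exact: wle_trans uv|exact: up_up|apply: uv; apply/(hg u) => //].
    exact: up_up.
  by rewrite inE fle_refl.
- move=> u x wu gx.
  (* On [F] a point below [x] sees [x], so the implication holds only where [nd x] does. Its failure
     at [u] yields a successor with [up x] but not [nd x], whose image can only be [x]. *)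
  have : ~ u (Var (c1 (up x)) ~> Var (c1 (nd x))).
    move=> h; suff : u (Var (c1 (nd x))) by move/(hg u wu _ (nd_up x)); rewrite inE gx.
    apply: w_mp h; apply: fact => //= [p|y z _ h].
      by rewrite !inE -orbA => /or3P[] /eqP ->.
    apply/V1 => y' zy'; rewrite inE; apply/negP => y'x.
    have /V1 /(_ x (fle_refl x)) : V (c1 (nd x)) x.
      apply: h; first exact: fle_trans y'x.
      by apply/V1 => z'; rewrite inE.
    by rewrite inE fle_refl.
  move=> /w_imp h; apply: contrapT => nex; apply: h => // v uv ux.
  have wv : wle w v by apply: wle_trans uv.
  apply: contrapT => nnd; apply: nex; exists v => //.
  move/(hg v wv _ (up_up x)): ux; rewrite inE => xg.
  apply: fle_anti; rewrite xg andbT; apply: contrapT => /negP h; apply: nnd.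
  by apply/(hg v wv _ (nd_up x)); rewrite inE.
- by move=> S upS u wu; apply: hg.
- move=> S upS u wu; have upS' y z : fle y z -> y \in f @^-1: S -> z \in f @^-1: S.
    by rewrite !inE => /f_mono; apply: upS.
  have := hg u wu _ upS'; rewrite inE => <-; split; apply: w_mp; apply: fact => //=.
  + by move=> p; rewrite !inE => /orP[] /eqP ->.
  + by move=> x y _ /V0 h; apply/V1 => z /h; rewrite inE.
  + by move=> p; rewrite !inE => /orP[] /eqP ->.
  + by move=> x y _ /V1 h; apply/V0 => z /h; rewrite inE.
Qed.

End Side.

(** * From Craig interpolation to amalgamation *)

Section Amalgam.
Variables (L : form -> Prop) (hL : intermediate_logic L) (cip : CIP L).
Variables (F1 F2 F0 : frame) (f1 : F1 -> F0) (f2 : F2 -> F0) (r1 : F1) (r2 : F2).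
Hypotheses (pm1 : pmorph f1) (pm2 : pmorph f2).
Hypotheses (v1 : fvalid L F1) (v2 : fvalid L F2).
Hypotheses (hr1 : forall x, fle r1 x) (hr2 : forall x, fle r2 x).
Hypothesis single : forall x, f1 x = f2 r2 -> x = r1.
Hypothesis same : f1 r1 = f2 r2.

(** Subsets of [F0] get shared variables, those of [F1] and [F2] private ones, so that an
    interpolant between the two sides speaks about [F0] only. *)
Let code : countType := ({set F0} + ({set F1} + {set F2}))%type.
Let c0 (S : {set F0}) : var := choice.pickle (inl S : code).
Let c1 (S : {set F1}) : var := choice.pickle (inr (inl S) : code).
Let c2 (S : {set F2}) : var := choice.pickle (inr (inr S) : code).

Let V0 (p : var) (x : F0) : Prop :=
  if (choice.unpickle p : option code) is Some (inl D) then forall y, fle x y -> y \in D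
  else False.
Let V1 (p : var) (x : F1) : Prop :=
  match choice.unpickle p : option code with
  | Some (inl D) => forall y, fle x y -> f1 y \in D
  | Some (inr (inl D)) => forall y, fle x y -> y \in D
  | _ => False
  end.
Let V2 (p : var) (x : F2) : Prop :=
  match choice.unpickle p : option code with
  | Some (inl D) => forall y, fle x y -> f2 y \in D
  | Some (inr (inr D)) => forall y, fle x y -> y \in D
  | _ => False
  end.
Let is0 (p : var) := if (choice.unpickle p : option code) is Some (inl _) then true else false.
Let cls1 (p : var) :=
  if (choice.unpickle p : option code) is Some (inl _ | inr (inl _)) then true else false.
Let cls2 (p : var) :=
  if (choice.unpickle p : option code) is Some (inl _ | inr (inr _)) then true else false.

Let leF (F : frame) := fun x y : F => fle x y : Prop.
Let T1 C := (forall p, p \in vars C -> cls1 p) /\ forces (@leF F1) V1 r1 C.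
Let T2 C := (forall p, p \in vars C -> cls2 p) /\ forces (@leF F2) V2 r2 C.

Let up1 : upward (@leF F1) V1 (fun _ => True).
Proof.
move=> p x y _; rewrite /leF /V1 => xy; case: choice.unpickle => [[S|[S|S]]|] // h z yz; apply: h;
exact: fle_trans yz.
Qed.

Let up2 : upward (@leF F2) V2 (fun _ => True).
Proof.
move=> p x y _; rewrite /leF /V2 => xy; case: choice.unpickle => [[S|[S|S]]|] // h z yz; apply: h;
exact: fle_trans yz.
Qed.

Let compact C : ded L (fun D => T1 D \/ T2 D) C ->
  exists B1 B2, [/\ T1 B1, T2 B2 & L (B1 ~> B2 ~> C)].
Proof.
have T1top : T1 (Neg Bot) by split=> // x _.
have T2top : T2 (Neg Bot) by split=> // x _.
have sem B1 B2 D : L (B1 ~> B2 ~> D) <-> forall w : world L, w B1 -> w B2 -> w D.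
  rewrite (logic_impP hL); split=> [h w /h /w_imp|h w h1]; first by apply.
  by apply/w_imp => // u lu; apply: h; apply: lu.
elim=> {C} [C [h|h]|C h|C D _ [B1 [B2 [t1 t2 /sem h]]] _ [B1' [B2' [t1' t2' /sem h']]]].
- by exists C, (Neg Bot); split=> //; apply/sem.
- by exists (Neg Bot), C; split=> //; apply/sem.
- by exists (Neg Bot), (Neg Bot); split=> //; apply/sem => w _ _; apply: w_logic.
- exists (And B1 B1'), (And B2 B2'); split.
  + case: t1 t1' => [a1 a2] [b1 b2]; split=> [p|]; last by [].
    by rewrite inE => /orP[]; auto.
  + case: t2 t2' => [a1 a2] [b1 b2]; split=> [p|]; last by [].
    by rewrite inE => /orP[]; auto.
  + apply/sem => w /(w_and hL) [a1 a1'] /(w_and hL) [a2 a2'].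
    exact: w_mp (h w a1 a2) (h' w a1' a2').
Qed.

Let nc2 : {set F2} := [set y | y != r2].

(** A derivation would give an interpolant in the shared variables. It holds at [r1], hence at the
    common image of the roots, hence at [r2], where it would imply a formula that fails. *)
Let not_ded : ~ ded L (fun D => T1 D \/ T2 D) (Var (c2 nc2)).
Proof.
move=> /compact [B1 [B2 [[cB1 hB1] [cB2 hB2] hd]]].
have [C [/fsubsetP hC hd1 hd2]] := cip hd.
have cC p : p \in vars C -> is0 p.
  move=> /hC; rewrite !inE => /andP[/cB1 + ]; rewrite /cls1 /is0 => h1.
  move=> /orP[/cB2|/eqP]; rewrite /cls2; first by case: choice.unpickle h1 => [[S|[S|S]]|].
  by move=> pE; move: h1; rewrite pE /c2 choice.pickleK.
have r1C : forces (@leF F1) V1 r1 C := v1 hd1 up1 r1 r1 (fle_refl r1) hB1.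
have r0C : forces (@leF F0) V0 (f1 r1) C.
  apply/(@forces_map _ _ (@leF F1) (@leF F0) V1 V0 f1 C (proj1 pm1) (proj2 pm1)) => //.
  move=> p x /cC; rewrite /is0 /V1 /V0; case: choice.unpickle => [[S|//]|//] _; split.
    by move=> h y0 /(proj2 pm1) [y xy <-]; apply: h.
  by move=> h y /(proj1 pm1); apply: h.
have r2C : forces (@leF F2) V2 r2 C.
  apply/(@forces_map _ _ (@leF F2) (@leF F0) V2 V0 f2 C (proj1 pm2) (proj2 pm2)).
    move=> p x /cC; rewrite /is0 /V2 /V0; case: choice.unpickle => [[S|//]|//] _; split.
      by move=> h y0 /(proj2 pm2) [y xy <-]; apply: h.
    by move=> h y /(proj1 pm2); apply: h.
  by rewrite -same.
have := v2 hd2 up2 r2 _ (fle_refl r2) r2C _ (fle_refl r2) hB2.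
by rewrite /= /V2 /c2 choice.pickleK => /(_ r2 (fle_refl r2)); rewrite inE eqxx.
Qed.

(** Only one side can be kept at its root by an omitted formula: a disjunction over both private
    vocabularies would not fit an implication between the two sides. So [w] omits the formula of
    [F2], which gives [g2 w = r2], and [single] then fixes [g1 w]. *)
Lemma amalgam : exists (w : world L) (g1 : world L -> F1) (g2 : world L -> F2),
  [/\ g1 w = r1 /\ g2 w = r2,
      (forall u v, wle w u -> wle u v -> fle (g1 u) (g1 v)) /\
      (forall u x, wle w u -> fle (g1 u) x -> exists2 v, wle u v & g1 v = x),
      (forall u v, wle w u -> wle u v -> fle (g2 u) (g2 v)) /\
      (forall u x, wle w u -> fle (g2 u) x -> exists2 v, wle u v & g2 v = x),
      forall u, wle w u -> f1 (g1 u) = f2 (g2 u)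
    & (forall x, exists phi, forall u : world L, wle w u -> u phi <-> fle x (g1 u)) /\
      (forall x, exists phi, forall u : world L, wle w u -> u phi <-> fle x (g2 u))].
Proof.
have [w hw nw] := lindenbaum hL not_ded; exists w.
have [|||||||g1 [m1 b1 s1 s10]] := @side_map L hL F1 F0 f1 r1 V1 c0 c1 cls1 _ _ _ _ _ w.
- exact: (proj1 pm1).
- by move=> S x; rewrite /V1 /c0 choice.pickleK.
- by move=> S x; rewrite /V1 /c1 choice.pickleK.
- by move=> S; rewrite /cls1 /c0 choice.pickleK.
- by move=> S; rewrite /cls1 /c1 choice.pickleK.
- by move=> C h1 h2; apply: hw; left; split.
- by [].
have [|||||||g2 [m2 b2 s2 s20]] := @side_map L hL F2 F0 f2 r2 V2 c0 c2 cls2 _ _ _ _ _ w.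
- exact: (proj1 pm2).
- by move=> S x; rewrite /V2 /c0 choice.pickleK.
- by move=> S x; rewrite /V2 /c2 choice.pickleK.
- by move=> S; rewrite /cls2 /c0 choice.pickleK.
- by move=> S; rewrite /cls2 /c2 choice.pickleK.
- by move=> C h1 h2; apply: hw; right; split.
- by [].
have eqg u : wle w u -> f1 (g1 u) = f2 (g2 u).
  move=> wu; have ups (x : F0) y z : fle y z -> y \in [set t | fle x t] -> z \in [set t | fle x t].
    by rewrite !inE => yz xy; apply: fle_trans yz.
  apply: fle_anti; apply/andP; split.
    suff : f2 (g2 u) \in [set t | fle (f1 (g1 u)) t] by rewrite inE.
    by apply/(s20 _ (ups _) _ wu)/(s10 _ (ups _) _ wu); rewrite inE fle_refl.
  suff : f1 (g1 u) \in [set t | fle (f2 (g2 u)) t] by rewrite inE.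
  by apply/(s10 _ (ups _) _ wu)/(s20 _ (ups _) _ wu); rewrite inE fle_refl.
have g2w : g2 w = r2.
  have := s2 nc2 _ w (@wle_refl L w); case=> [y z yz|_ h].
    rewrite !inE; apply: contra => /eqP zr; apply/eqP; apply: fle_anti.
    by rewrite -zr yz zr hr2.
  by apply/eqP; apply: contrapT => /negP hn; apply: nw; apply: h; rewrite inE.
exists g1, g2; split=> //.
- by split=> //; apply: single; rewrite eqg // g2w.
- split=> x; [exists (Var (c1 [set y | fle x y]))|exists (Var (c2 [set y | fle x y]))] => u wu.
  + by rewrite s1 // ?inE // => y z yz; rewrite !inE => xy; apply: fle_trans yz.
  + by rewrite s2 // ?inE // => y z yz; rewrite !inE => xy; apply: fle_trans yz.
Qed.

End Amalgam.

Definition one_frame : frame.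
Proof. by refine (@Frame unit (fun _ _ => true) _ _ _) => // -[] []. Defined.

Definition plus_le (X : frame) (a b : option X) :=
  match a, b with
  | None, _ => true
  | Some x, Some y => fle x y
  | Some _, None => false
  end.

Definition plus_frame (X : frame) : frame.
Proof.
refine (@Frame (option X) (@plus_le X) _ _ _).
- by case=> [x|] //=; apply: fle_refl.
- by case=> [y|] [x|] [z|] //=; apply: fle_trans.
- by case=> [x|] [y|] //= /fle_anti ->.
Defined.

Definition sum_le (X Y : frame) (a b : X + Y) :=
  match a, b with
  | inl x, inl y => fle x y
  | inr x, inr y => fle x y
  | _, _ => false
  end.

Definition sum_frame (X Y : frame) : frame.
Proof.
refine (@Frame (X + Y)%type (@sum_le X Y) _ _ _).
- by case=> x /=; apply: fle_refl.
- by case=> y [x|x] [z|z] //=; apply: fle_trans.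
- by case=> x [y|y] //= /fle_anti ->.
Defined.

Definition top_le (B : finType) (X : frame) (a b : X + B) :=
  match a, b with
  | inl x, inl y => fle x y
  | inr _, inl _ => false
  | _, inr _ => true
  end.

(* B has at most one point: adding it on top covers frames with a largest element
   (B = unit) and arbitrary frames (B = void) at once. *)
Definition top_frame (B : finType) (hB : forall s t : B, s = t) (X : frame) : frame.
Proof.
refine (@Frame (X + B)%type (@top_le B X) _ _ _).
- by case=> x //=; apply: fle_refl.
- by case=> y [x|x] [z|z] //=; apply: fle_trans.
- by case=> x [y|y] //= => [/fle_anti|_]; [move=> ->|rewrite (hB x y)].
Defined.

Notation two_chain := (plus_frame one_frame).
Notation three_chain := (plus_frame two_chain).
Notation two_points := (sum_frame one_frame one_frame).
Notation fork := (plus_frame two_points).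

(** A set pulled back along [K] is a finite union of intersections of definable sets from the two
    sides, hence definable. Monotonicity of [K] matters only on pairs over a common point, as no
    other pairs occur. *)
Lemma valid_amalgam (L : form -> Prop) (hL : intermediate_logic L) (F1 F2 F0 Y : frame)
    (f1 : F1 -> F0) (f2 : F2 -> F0) (K : F1 -> F2 -> Y) (w u0 : world L) g1 g2 :
  (forall u v, wle w u -> wle u v -> fle (g1 u) (g1 v)) ->
  (forall u v, wle w u -> wle u v -> fle (g2 u) (g2 v)) ->
  (forall u, wle w u -> f1 (g1 u) = f2 (g2 u)) ->
  (forall x, exists phi, forall u : world L, wle w u -> u phi <-> fle x (g1 u)) ->
  (forall x, exists phi, forall u : world L, wle w u -> u phi <-> fle x (g2 u)) ->
  wle w u0 ->
  (forall x y x' y', f1 x = f2 y -> f1 x' = f2 y' -> fle x x' -> fle y y' ->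
     fle (K x y) (K x' y')) ->
  (forall u z, wle u0 u -> fle (K (g1 u) (g2 u)) z ->
     exists2 v, wle u v & K (g1 v) (g2 v) = z) ->
  (forall z, fle (K (g1 u0) (g2 u0)) z) -> fvalid L Y.
Proof.
move=> m1 m2 eqg /choice [d1 hd1] /choice [d2 hd2] wu0 monoK back root.
have wt u : wle u0 u -> wle w u by apply: wle_trans.
apply: (@valid_definable L hL Y _ u0 (fun u => K (g1 u) (g2 u))) => //.
- move=> u v /wt wu uv; have wv := wle_trans wu uv.
  by apply: monoK; rewrite ?eqg //; [apply: m1|apply: m2].
move=> S upS.
exists (bigor [seq And (d1 xy.1) (d2 xy.2) | xy <- enum {: F1 * F2} &
   (f1 xy.1 == f2 xy.2) && `[< S (K xy.1 xy.2) >]]) => u /wt wu.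
rewrite (w_bigor hL); split.
  move=> [C /mapP [[x y]]]; rewrite mem_filter /= => /andP[/andP[/eqP exy /asboolP hS] _] ->.
  move=> /(w_and hL) [/hd1 -/(_ wu) h1 /hd2 -/(_ wu) h2].
  by apply: upS hS; apply: monoK => //; apply: eqg.
move=> hS; exists (And (d1 (g1 u)) (d2 (g2 u))).
  apply/mapP; exists (g1 u, g2 u) => //; rewrite mem_filter mem_enum andbT /=.
  by rewrite eqg // eqxx; apply/asboolP.
by apply/(w_and hL); split; [apply/hd1|apply/hd2]; rewrite ?fle_refl.
Qed.

(** What remains of an amalgam once its worlds are forgotten; the steps below argue only about pairs
    of points over the same base point. *)
Record cone (X1 X2 X0 : frame) (f1 : X1 -> X0) (f2 : X2 -> X0) := Cone {
  cpt :> Type;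
  cle : cpt -> cpt -> Prop;
  cfst : cpt -> X1;
  csnd : cpt -> X2;
  cle_refl : forall u, cle u u;
  cle_trans : forall u v t, cle u v -> cle v t -> cle u t;
  cfst_mono : forall u v, cle u v -> fle (cfst u) (cfst v);
  csnd_mono : forall u v, cle u v -> fle (csnd u) (csnd v);
  cfst_back : forall u x, fle (cfst u) x -> exists2 v, cle u v & cfst v = x;
  csnd_back : forall u x, fle (csnd u) x -> exists2 v, cle u v & csnd v = x;
  cone_eq : forall u, f1 (cfst u) = f2 (csnd u) }.

(** * Larger frames from the fork and the three-element chain *)

Section Steps.
Variables (L : form -> Prop) (hL : intermediate_logic L) (cip : CIP L).
Variables (B : finType) (hB : forall s t : B, s = t).

Notation top X := (top_frame hB X).

Definition top_map (X Y : frame) (f : X -> Y) (x : top X) : top Y :=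
  match x with inl x => inl (f x) | inr b => inr b end.

Lemma top_pmorph (X Y : frame) (f : X -> Y) : pmorph f -> pmorph (top_map f).
Proof.
move=> [mono back]; split=> [[x|b] [y|c]|[x|b] [y|c]] //=; first exact: mono.
- by move=> /back [x' xx' <-]; exists (inl x').
- by move=> _; exists (inr c).
- by move=> _; exists (inr c).
Qed.

Lemma top_valid_pmorph (X Y : frame) (f : X -> Y) : pmorph f ->
  (forall y, exists x, f x = y) -> fvalid L (top X) -> fvalid L (top Y).
Proof.
move=> pf surj; apply: (@valid_pmorph L (top X) (top Y) _ _ (@top_map X Y f)).
- exact: (proj1 (top_pmorph pf)).
- exact: (proj2 (top_pmorph pf)).
- by case=> [y|b]; [have [x <-] := surj y; exists (inl x)|exists (inr b)].
Qed.

(** An added top lies over the top of the base only, so a world has both images on top or neither;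
    discarding the former leaves a cone over the frames without tops. The last clause reduces
    validity of [top Y] to a suitable map on pairs. *)
Lemma amalgam_cone (X1 X2 X0 : frame) (f1 : X1 -> X0) (f2 : X2 -> X0) (r1 : X1) (r2 : X2) :
  pmorph f1 -> pmorph f2 -> fvalid L (top X1) -> fvalid L (top X2) ->
  (forall x, fle r1 x) -> (forall x, fle r2 x) ->
  (forall x, f1 x = f2 r2 -> x = r1) -> f1 r1 = f2 r2 ->
  exists (C : cone f1 f2) (w : C), [/\ cfst w = r1, csnd w = r2 &
    forall (Y : frame) (H : X1 -> X2 -> Y) (u0 : C),
    (forall x y x' y', f1 x = f2 y -> f1 x' = f2 y' -> fle x x' -> fle y y' ->
       fle (H x y) (H x' y')) ->
    (forall u z, cle u0 u -> fle (H (cfst u) (csnd u)) z ->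
       exists2 v, cle u v & H (cfst v) (csnd v) = z) ->
    (forall z, fle (H (cfst u0) (csnd u0)) z) -> fvalid L (top Y)].
Proof.
move=> p1 p2 v1 v2 hr1 hr2 single same.
have [||||w [g1 [g2 [[g1w g2w] [m1 b1] [m2 b2] eqg [d1 d2]]]]] :=
  @amalgam L hL cip (top X1) (top X2) (top X0) (@top_map X1 X0 f1) (@top_map X2 X0 f2)
    (inl r1) (inl r2) (top_pmorph p1) (top_pmorph p2) v1 v2.
- by case=> [x|b] /=.
- by case=> [x|b] /=.
- by case=> [x|b] //= [/single ->].
- by rewrite /= same.
pose P (t : world L * X1 * X2) :=
  [/\ wle w t.1.1, g1 t.1.1 = inl t.1.2 & g2 t.1.1 = inl t.2].
have case12 u x : wle w u -> g1 u = inl x -> exists y, g2 u = inl y.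
  by move=> wu gx; have := eqg u wu; rewrite gx; case: (g2 u) => // y _; exists y.
have case21 u y : wle w u -> g2 u = inl y -> exists x, g1 u = inl x.
  by move=> wu gx; have := eqg u wu; rewrite gx; case: (g1 u) => // x _; exists x.
pose cl (s t : {t | P t}) := wle (sval s).1.1 (sval t).1.1.
have crefl u : cl u u by [].
have ctrans u v t : cl u v -> cl v t -> cl u t by apply: wle_trans.
have cm1 u v : cl u v -> fle (sval u).1.2 (sval v).1.2.
  case: u v => [[[u x] y] /= [wu e1 e2]] [[[v x'] y'] /= [wv e1' e2']].
  by rewrite /cl /= => /(m1 _ _ wu); rewrite e1 e1'.
have cm2 u v : cl u v -> fle (sval u).2 (sval v).2.
  case: u v => [[[u x] y] /= [wu e1 e2]] [[[v x'] y'] /= [wv e1' e2']].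
  by rewrite /cl /= => /(m2 _ _ wu); rewrite e2 e2'.
have cb1 u x : fle (sval u).1.2 x -> exists2 v, cl u v & (sval v).1.2 = x.
  case: u => [[[u x0] y] /= pu]; case: (pu) => /= wu e1 e2 xx.
  have [v uv gv] : exists2 v, wle u v & g1 v = inl x by apply: b1 => //; rewrite e1.
  have wv := wle_trans wu uv; have [y' gy'] := case12 _ _ wv gv.
  have pv : P (v, x, y') by [].
  by exists (exist _ _ pv).
have cb2 u x : fle (sval u).2 x -> exists2 v, cl u v & (sval v).2 = x.
  case: u => [[[u x0] y] /= pu]; case: (pu) => /= wu e1 e2 xx.
  have [v uv gv] : exists2 v, wle u v & g2 v = inl x by apply: b2 => //; rewrite e2.
  have wv := wle_trans wu uv; have [y' gy'] := case21 _ _ wv gv.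
  have pv : P (v, y', x) by [].
  by exists (exist _ _ pv).
have ceq (u : {t | P t}) : f1 (sval u).1.2 = f2 (sval u).2.
  by case: u => [[[u x] y] /= [wu e1 e2]]; have := eqg u wu; rewrite e1 e2 => -[].
have pw : P (w, r1, r2) by split=> //; apply: wle_refl.
exists (@Cone X1 X2 X0 f1 f2 {t | P t} cl _ _ crefl ctrans cm1 cm2 cb1 cb2 ceq).
exists (exist _ _ pw); split=> //= Y H [[[u0 x0] y0] pu0] monoH back root.
pose K (a : top X1) (b : top X2) : top Y :=
  match a, b with
  | inl x, inl y => inl (H x y)
  | inr c, _ => inr c
  | _, inr c => inr c
  end.
case: (pu0) => /= wu0 e1 e2.
apply: (@valid_amalgam L hL _ _ _ (top Y) _ _ K w u0 g1 g2 m1 m2 eqg d1 d2 wu0).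
- move=> [x|b] [y|c] [x'|b'] [y'|c'] //= [exy] [exy']; exact: monoH.
- move=> u z u0u; have wu := wle_trans wu0 u0u.
  case gx: (g1 u) => [x|b].
    have [y gy] := case12 _ _ wu gx; rewrite gy /=.
    case: z => [z|b] hz.
      have pu : P (u, x, y) by [].
      have [[[[v x'] y'] [/= wv gv1 gv2]] uv hv] := back (exist _ _ pu) z u0u hz.
      by exists v => //; rewrite gv1 gv2 /=; congr inl.
    have [v uv gv] : exists2 v, wle u v & g1 v = inr b by apply: b1; rewrite // gx.
    by exists v => //; rewrite gv.
  by case: z => [z|c] // _; exists u; rewrite // gx /= (hB b c).
- by rewrite e1 e2; case=> [z|b] //=; apply: root.
Qed.

Lemma frame_max (X : frame) (x0 : X) : exists m : X, forall y, fle m y -> y = m.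
Proof.
have [m _ minm] := @arg_minnP X x0 predT (fun x => #|[set y | fle x y]|) isT.
exists m => y my; apply: fle_anti; rewrite my andbT.
have /minm := erefl : predT y; rewrite leqNgt; apply: contraNT => nym.
apply/proper_card/properP; split.
  by apply/fintype.subsetP => z; rewrite !inE; apply: fle_trans.
by exists m; rewrite !inE ?fle_refl.
Qed.

(** The lower two points of the three-element chain lie over the same base point as the root below
    [X], which thereby splits into two levels. *)
Lemma step_plus (X : frame) (x0 : X) :
  fvalid L (top (plus_frame X)) -> fvalid L (top three_chain) ->
  fvalid L (top (plus_frame (plus_frame X))).
Proof.
move=> v1 v2.
pose f1 (a : plus_frame X) : two_chain := if a is Some _ then Some tt else None.
pose f2 (a : three_chain) : two_chain := if a is Some (Some _) then Some tt else None.
have [||||||C [w [w1 w2 tr]]] := @amalgam_cone _ _ _ f1 f2 None None _ _ v1 v2.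
- split=> [[x|] [y|]|[x|] [[]|]] //=.
  + by exists (Some x) => //=; apply: fle_refl.
  + by exists (Some x0).
  + by exists None.
- split=> [[[x|]|] [[y|]|]|[[[]|]|] [[]|]] //= _.
  + by exists (Some (Some tt)).
  + by exists (Some (Some tt)).
  + by exists (Some None).
  + by exists (Some (Some tt)).
  + by exists None.
- by case.
- by case.
- by case=> //= x.
- by [].
apply: (tr _ (fun (a : plus_frame X) (b : three_chain) => match a, b with
  | Some x, _ => Some (Some x) | None, Some _ => Some None | None, None => None
  end : plus_frame (plus_frame X)) w).
- by move=> [x|] [[[]|]|] [x'|] [[[]|]|].
- move=> u z _; have := cone_eq u; case e1: (cfst u) => [x|]; case e2: (csnd u) => [[[]|]|] //= _.
  + case: z => [[x'|]|] //= xx.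
    have [v uv ev] : exists2 v, cle u v & cfst v = Some x' by apply: cfst_back; rewrite e1.
    by exists v => //; rewrite ev.
  + case: z => [[x'|]|] //= _; last by exists u; [exact: cle_refl|rewrite e1 ?e2].
    have [v uv ev] : exists2 v, cle u v & cfst v = Some x' by apply: cfst_back; rewrite e1.
    by exists v => //; rewrite ev.
  + case: z => [[x'|]|] //= _; last by exists u; [exact: cle_refl|rewrite e1 ?e2].
      have [v uv ev] : exists2 v, cle u v & cfst v = Some x' by apply: cfst_back; rewrite e1.
      by exists v => //; rewrite ev.
    have [v uv ev] : exists2 v, cle u v & csnd v = Some None by apply: csnd_back; rewrite e2.
    by exists v => //; have := cone_eq v; rewrite ev; case: (cfst v).
- by rewrite w1 ?w2.
Qed.

Notation hook := (plus_frame (sum_frame two_chain one_frame)).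

(** The middle of the chain lies over a leaf of the fork, but which one is not under control. Either
    every point over the root sees it over the left leaf, or above some point that does not, all
    points over the root see it over the right leaf. The other branch is collapsed. *)
Lemma step_hook : fvalid L (top fork) -> fvalid L (top three_chain) -> fvalid L (top hook).
Proof.
move=> v1 v2.
pose f1 (a : fork) : two_chain := if a is Some _ then Some tt else None.
pose f2 (a : three_chain) : two_chain := if a is Some _ then Some tt else None.
have [||||||C [w [w1 w2 tr]]] := @amalgam_cone _ _ _ f1 f2 None None _ _ v1 v2.
- split=> [[x|] [y|]|[x|] [[]|]] //= _.
  + by exists (Some x) => //=; apply: (@fle_refl two_points).
  + by exists (Some (inl tt)).
  + by exists None.
- split=> [[[x|]|] [[y|]|]|[[[]|]|] [[]|]] //= _.
  + by exists (Some (Some tt)).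
  + by exists (Some None).
  + by exists (Some None).
  + by exists None.
- by case.
- by case.
- by case.
- by [].
pose side (e : bool) : two_points := if e then inl tt else inr tt.
have side_le e (u v : C) : cle u v -> cfst u = Some (side e) -> cfst v = Some (side e).
  move=> /cfst_mono + eu; rewrite eu; case: (cfst v) => [[[]|[]]|]; by case: e {eu}.
pose sees e (u : C) := exists v, [/\ cle u v, cfst v = Some (side e) & csnd v = Some None].
have key e (u0 : C) : cfst u0 = None ->
    (forall u, cle u0 u -> cfst u = None -> sees e u) -> fvalid L (top hook).
  move=> e0 hs.
  apply: (tr _ (fun (a : fork) (b : three_chain) =>
    (if a is Some c then
      if c == side e then
        Some (inl (if b is Some (Some _) then Some tt else None))
      else Some (inr tt)
    else None) : hook) u0).
  - by move: e {hs} => [] [[[]|[]]|] [[[]|]|] [[[]|[]]|] [[[]|]|].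
  - move=> u z u0u; have := cone_eq u; case e1: (cfst u) => [c|] => [|_].
      case e2: (csnd u) => [b|] //= _; case: eqP => [ce|nce].
        case: b e2 => [[]|] e2; case: z => [[[[]|]|]|] //= _.
        + by exists u; [exact: cle_refl|rewrite e1 e2 ce eqxx].
        + have [v uv ev] : exists2 v, cle u v & csnd v = Some (Some tt).
            by apply: csnd_back; rewrite e2.
          by exists v => //; rewrite ev (@side_le e _ _ uv) ?eqxx // e1 ce.
        + by exists u; [exact: cle_refl|rewrite e1 e2 ce eqxx].
      case: z => [[|[]]|] //= _; exists u; [exact: cle_refl|].
      by rewrite e1; case: eqP.
    case: z => [[[[]|]|[]]|] _.
    + have [v [uv ev1 ev2]] := hs u u0u e1.
      have [v' vv' ev'] : exists2 v', cle v v' & csnd v' = Some (Some tt).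
        by apply: csnd_back; rewrite ev2.
      exists v'; first exact: cle_trans vv'.
      by rewrite ev' (@side_le e _ _ vv') // eqxx.
    + have [v [uv ev1 ev2]] := hs u u0u e1; exists v => //; by rewrite ev1 ev2 eqxx.
    + have [v uv ev] : exists2 v, cle u v & cfst v = Some (side (~~ e)).
        by apply: cfst_back; rewrite e1.
      by exists v => //; rewrite ev; case: (e).
    + by exists u; [exact: cle_refl|rewrite e1].
  - by rewrite e0.
have [h|] := pselect (forall u, cle w u -> cfst u = None -> sees true u); first exact: key h.
move=> /existsNP [u /not_implyP [wu /not_implyP [eu nu]]].
apply: (key false u eu) => v uv ev.
have [t vt et] : exists2 t, cle v t & csnd t = Some None.
  by apply: csnd_back; have := cone_eq v; rewrite ev; case: (csnd v).
exists t; split=> //; have := cone_eq t; rewrite et.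
case e1: (cfst t) => [[[]|[]]|] //= _; case: nu; exists t; split=> //.
exact: cle_trans vt.
Qed.

(** The hook decides the branch: points of [X] paired with its long branch stay, those paired with
    its leaf merge into the new leaf. Above the middle point all of [X] survives, because the long
    branch is closed upwards. *)
Lemma step_plus_sum (X : frame) (x0 : X) :
  fvalid L (top (plus_frame (plus_frame X))) -> fvalid L (top hook) ->
  fvalid L (top (plus_frame (sum_frame (plus_frame X) one_frame))).
Proof.
move=> v1 v2.
pose f1 (a : plus_frame (plus_frame X)) : three_chain := match a with
  | Some (Some _) => Some (Some tt) | Some None => Some None | None => None end.
pose f2 (a : hook) : three_chain := match a with
  | Some (inl None) => Some None | Some _ => Some (Some tt) | None => None end.
have [||||||C [w [w1 w2 tr]]] := @amalgam_cone _ _ _ f1 f2 None None _ _ v1 v2.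
- split=> [[[x|]|] [[y|]|]|[[x|]|] [[[]|]|]] //= _.
  + by exists (Some (Some x)) => //=; apply: fle_refl.
  + by exists (Some (Some x0)).
  + by exists (Some None).
  + by exists (Some (Some x0)).
  + by exists (Some None).
  + by exists None.
- split=> [[[[x|]|x]|] [[[y|]|y]|]|[[[[]|]|[]]|] [[[]|]|]] //= _.
  + by exists (Some (inl (Some tt))).
  + by exists (Some (inl (Some tt))).
  + by exists (Some (inl None)).
  + by exists (Some (inr tt)).
  + by exists (Some (inr tt)).
  + by exists (Some (inl None)).
  + by exists None.
- by case.
- by case.
- by case=> [[x|]|].
- by [].
apply: (tr _ (fun (a : plus_frame (plus_frame X)) (b : hook) => match a, b with
  | Some None, _ => Some (inl None)
  | Some (Some x), Some (inl _) => Some (inl (Some x))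
  | Some (Some _), Some (inr _) => Some (inr tt)
  | _, _ => None
  end : plus_frame (sum_frame (plus_frame X) one_frame)) w).
- by move=> [[x|]|] [[[[]|]|[]]|] [[x'|]|] [[[[]|]|[]]|].
- have up (u : C) x : csnd u = Some (inl None) \/ csnd u = Some (inl (Some tt)) ->
      fle (cfst u) (Some (Some x)) -> exists v : C,
      [/\ cle u v, cfst v = Some (Some x) & csnd v = Some (inl (Some tt))].
    move=> eu /cfst_back [v uv ev]; exists v; split=> //.
    have := csnd_mono uv; have := cone_eq v; rewrite ev.
    by case: eu => ->; case: (csnd v) => [[[[]|]|[]]|].
  move=> u z _; have := cone_eq u.
  case e1: (cfst u) => [[x|]|]; case e2: (csnd u) => [[[[]|]|[]]|] //= _.
  + case: z => [[[x'|]|]|] //= xx.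
    have [||v [uv ev1 ev2]] := up u x'; [by right|by rewrite e1|].
    by exists v => //; rewrite ev1 ev2.
  + by case: z => [[|[]]|] //= _; exists u; [exact: cle_refl|rewrite e1 ?e2].
  + case: z => [[[x'|]|]|] //= xx; last by exists u; [exact: cle_refl|rewrite e1 ?e2].
    have [||v [uv ev1 ev2]] := up u x'; [by left|by rewrite e1|].
    by exists v => //; rewrite ev1 ev2.
  + have [v uv ev] : exists2 v, cle u v & cfst v = Some None by apply: cfst_back; rewrite e1.
    have ev2 : csnd v = Some (inl None).
      by have := cone_eq v; rewrite ev; case: (csnd v) => [[[[]|]|[]]|].
    case: z => [[[x'|]|[]]|] //= _.
    * have [||t [vt et1 et2]] := up v x'; [by left|by rewrite ev|].
      by exists t; [exact: cle_trans vt|rewrite et1 et2].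
    * by exists v => //; rewrite ev.
    * have [t ut et] : exists2 t, cle u t & csnd t = Some (inr tt).
        by apply: csnd_back; rewrite e2.
      by exists t => //; have := cone_eq t; rewrite et; case: (cfst t) => [[]|].
    * by exists u; [exact: cle_refl|rewrite e1].
- by rewrite w1 ?w2.
Qed.

(** The spare leaf beside [X] is the slot into which another frame is amalgamated; this is what
    makes disjoint unions possible. *)
Definition good (X : frame) := fvalid L (top (plus_frame (sum_frame X one_frame))).

(** The spare leaf is folded onto the left leaf of the inner fork in one copy and onto the right
    leaf in the other, so two spare leaves are never paired. A pair over the inner root involves
    neither of them and yields the third class. *)
Lemma step_fork : good fork -> good two_points.
Proof.
move=> v; pose F := plus_frame (sum_frame fork one_frame).
pose f (e : bool) (a : F) : plus_frame fork := match a with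
  | None => None | Some (inl a) => Some a
  | Some (inr _) => Some (Some (if e then inl tt else inr tt)) end.
have pf e : pmorph (f e).
{ split=> [[[[[[]|[]]|]|[]]|] [[[[[]|[]]|]|[]]|]|[[[[[]|[]]|]|[]]|] [[[[]|[]]|]|]];
    case: e => //= _.
  all: try by exists (Some (inl (Some (inl tt)))).
  all: try by exists (Some (inl (Some (inr tt)))).
  all: try by exists (Some (inl None)).
  all: try by exists (Some (inr tt)).
  all: by exists None. }
have [||||C [w [w1 w2 tr]]] := @amalgam_cone _ _ _ (f true) (f false) None None (pf _) (pf _) v v.
- by case.
- by case.
- by case=> [[]|].
- by [].
apply: (tr _ (fun (a b : F) => match a, b with
  | Some (inl _), Some (inl _) => Some (inl (inl tt))
  | Some (inr _), _ => Some (inl (inr tt))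
  | _, Some (inr _) => Some (inr tt)
  | _, _ => None
  end : plus_frame (sum_frame two_points one_frame)) w).
- by move=> [[a|[]]|] [[b|[]]|] [[a'|[]]|] [[b'|[]]|].
- move=> u z _; have := cone_eq u.
  case e1: (cfst u) => [[a|[]]|]; case e2: (csnd u) => [[b|[]]|] //=;
    try by case: z => [[[[]|[]]|[]]|] //= _ _; exists u; [exact: cle_refl|rewrite e1 ?e2].
  move=> _ _; case: z => [[[[]|[]]|[]]|].
  + have [t ut et] : exists2 t, cle u t & cfst t = Some (inl None).
      by apply: cfst_back; rewrite e1.
    by exists t => //; have := cone_eq t; rewrite et; case: (csnd t) => [[]|].
  + have [t ut et] : exists2 t, cle u t & cfst t = Some (inr tt).
      by apply: cfst_back; rewrite e1.
    by exists t => //; rewrite et.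
  + have [t ut et] : exists2 t, cle u t & csnd t = Some (inr tt).
      by apply: csnd_back; rewrite e2.
    by exists t => //; have := cone_eq t; rewrite et; case: (cfst t) => [[]|].
  + by exists u; [exact: cle_refl|rewrite e1 ?e2].
- by rewrite w1 ?w2.
Qed.

(** Over each leaf of the fork one frame shows its body and the other its spare leaf, so a pair
    determines a point of the union. *)
Lemma step_sum (X Y : frame) (x0 : X) (y0 : Y) :
  good X -> good Y -> fvalid L (top (plus_frame (sum_frame X Y))).
Proof.
move=> v1 v2.
pose f (e : bool) (Z : frame) (a : plus_frame (sum_frame Z one_frame)) : fork := match a with
  | None => None | Some (inl _) => Some (if e then inl tt else inr tt)
  | Some (inr _) => Some (if e then inr tt else inl tt) end.
have pf e (Z : frame) (z0 : Z) : pmorph (@f e Z).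
{ split=> [[[x|x]|] [[y|y]|]|[[x|x]|] [[[]|[]]|]]; case: e => //= _.
  all: try by exists (Some (inl x)) => //=; apply: fle_refl.
  all: try by exists (Some (inl z0)).
  all: try by exists (Some (inr tt)).
  all: by exists None. }
have [||||C [w [w1 w2 tr]]] :=
  @amalgam_cone _ _ _ (@f true X) (@f false Y) None None (pf _ _ x0) (pf _ _ y0) v1 v2.
- by case.
- by case.
- by case=> [[]|].
- by [].
apply: (tr _ (fun (a : plus_frame (sum_frame X one_frame)) (b : plus_frame (sum_frame Y one_frame)) =>
  match a, b with
  | Some (inl x), _ => Some (inl x)
  | _, Some (inl y) => Some (inr y)
  | _, _ => None
  end : plus_frame (sum_frame X Y)) w).
- by move=> [[a|a]|] [[b|b]|] [[a'|a']|] [[b'|b']|].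
- move=> u z _; have := cone_eq u.
  case e1: (cfst u) => [[a|a]|]; case e2: (csnd u) => [[b|b]|] //= _.
  + case: z => [[x|y]|] //= ax.
    have [t ut et] : exists2 t, cle u t & cfst t = Some (inl x) by apply: cfst_back; rewrite e1.
    by exists t => //; rewrite et.
  + case: z => [[x|y]|] //= ax.
    have [t ut et] : exists2 t, cle u t & csnd t = Some (inl y) by apply: csnd_back; rewrite e2.
    by exists t => //; have := cone_eq t; rewrite et; case: (cfst t) => [[]|].
  + case: z => [[x|y]|] //= _.
    * have [t ut et] : exists2 t, cle u t & cfst t = Some (inl x) by apply: cfst_back; rewrite e1.
      by exists t => //; rewrite et.
    * have [t ut et] : exists2 t, cle u t & csnd t = Some (inl y) by apply: csnd_back; rewrite e2.
      by exists t => //; have := cone_eq t; rewrite et; case: (cfst t) => [[]|].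
    * by exists u; [exact: cle_refl|rewrite e1 ?e2].
- by rewrite w1 ?w2.
Qed.

Lemma good_assoc (X Y : frame) :
  fvalid L (top (plus_frame (sum_frame X (sum_frame Y one_frame)))) -> good (sum_frame X Y).
Proof.
apply: (top_valid_pmorph (f := fun a : plus_frame (sum_frame X (sum_frame Y one_frame)) =>
  match a with
  | None => None | Some (inl x) => Some (inl (inl x))
  | Some (inr (inl y)) => Some (inl (inr y)) | Some (inr (inr t)) => Some (inr t)
  end : plus_frame (sum_frame (sum_frame X Y) one_frame))).
{ split=> [[[x|[x|x]]|] [[y|[y|y]]|]|[[x|[x|x]]|] [[[y|y]|y]|]] //= h.
  all: try by exists None.
  all: try by exists (Some (inl y)).
  all: try by exists (Some (inr (inl y))).
  all: by exists (Some (inr (inr y))). }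
- case=> [[[y|y]|y]|].
  + by exists (Some (inl y)).
  + by exists (Some (inr (inl y))).
  + by exists (Some (inr (inr y))).
  + by exists None.
Qed.

(** [step_sum] uses up the spare leaves. One is therefore attached to [Y] in advance, and
    [good two_points] is what leaves yet another spare one beside the result. *)
Lemma good_sum (X Y : frame) (x0 : X) (y0 : Y) :
  good two_points -> good X -> good Y -> good (sum_frame X Y).
Proof.
move=> g2 gX gY; apply: good_assoc; apply: step_sum => //; first exact: (inr tt).
by apply: good_assoc; apply: step_sum => //; exact: (inr tt).
Qed.

(** The spare leaf can be folded onto a maximal point of [X]. *)
Lemma plus_of_good (X : frame) (x0 : X) : good X -> fvalid L (top (plus_frame X)).
Proof.
have [m hm] := frame_max x0.
apply: (top_valid_pmorph (f := fun a : plus_frame (sum_frame X one_frame) => match a with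
  | None => None | Some (inl x) => Some x | Some (inr _) => Some m end : plus_frame X)).
- split=> [[[x|x]|] [[y|y]|]|[[x|x]|] [y|]] //= h.
  + exact: fle_refl.
  + by exists (Some (inl y)).
  + by exists (Some (inr x)); rewrite // (hm y).
  + by exists (Some (inl y)).
  + by exists None.
- by case=> [x|]; [exists (Some (inl x))|exists None].
Qed.

Lemma good_plus (X : frame) (x0 : X) : fvalid L (top fork) -> fvalid L (top three_chain) ->
  fvalid L (top (plus_frame X)) -> good (plus_frame X).
Proof.
move=> v1 v2 vX; apply: step_plus_sum => //; last exact: step_hook.
exact: step_plus.
Qed.

End Steps.

(** * Completeness for trees *)

Fixpoint subs (A : form) : seq form :=
  A :: match A with
       | And B C | Or B C | Imp B C => subs B ++ subs C
       | Neg B => subs B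
       | _ => [::]
       end.

Lemma subs_refl A : A \in subs A.
Proof. by case: A => *; rewrite /= mem_head. Qed.

Lemma subs_trans A B : B \in subs A -> {subset subs B <= subs A}.
Proof.
elim: A => [p|//|A1 IA A2 IB|A1 IA A2 IB|A1 IA|A1 IA A2 IB]; rewrite inE.
- by move=> /eqP ->.
- by move=> /eqP ->.
all: case/orP=> [/eqP -> //|]; rewrite ?mem_cat.
all: try case/orP=> h; try move=> h.
all: move=> C; first [move=> /(IA h)|move=> /(IB h)] => h'.
all: by rewrite inE ?mem_cat h' !orbT.
Qed.

Lemma subs_closed A E : E \in subs A ->
  match E with
  | And B C | Or B C | Imp B C => (B \in subs A) && (C \in subs A)
  | Neg B => B \in subs A
  | _ => true
  end.
Proof.
move=> /subs_trans h; case: E h => // [B C|B C|B|B C] h.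
- by rewrite !h // inE mem_cat subs_refl !orbT.
- by rewrite !h // inE mem_cat subs_refl !orbT.
- by rewrite !h // inE subs_refl !orbT.
- by rewrite !h // inE mem_cat subs_refl !orbT.
Qed.

(** Forced formulas persist, so this number can only fall along the order, and where it stays the
    same the theory inside [s] is unchanged. It measures progress in the inductions below. *)
Definition defect (s : seq form) (Th : form -> Prop) := count (fun C => ~~ `[< Th C >]) s.

Lemma defect_le s (Th Th' : form -> Prop) :
  (forall C, Th C -> Th' C) -> defect s Th' <= defect s Th.
Proof. by move=> h; apply: sub_count => C; apply: contra => /asboolP hC; apply/asboolP/h. Qed.

Lemma defect_eq s (Th Th' : form -> Prop) : (forall C, Th C -> Th' C) ->
  ~ (defect s Th' < defect s Th) -> forall C, C \in s -> Th' C -> Th C.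
Proof.
move=> h hd C Cs hC; apply: contrapT => nC; apply: hd.
elim: s Cs => [//|D s IH]; rewrite inE /defect /= => /orP[/eqP <-|/IH hs].
  have -> : `[< Th C >] = false by apply/asboolP.
  by have -> : `[< Th' C >] by [apply/asboolP]; rewrite add0n add1n ltnS; apply: defect_le.
apply: leq_ltn_trans (_ : (~~ `[< Th D >]) + defect s Th' < _); last by rewrite ltn_add2l.
rewrite leq_add2r; case: (boolP `[< Th D >]) => [/asboolP hD|_]; last by case: asboolP.
by have -> : `[< Th' D >] by apply/asboolP/h.
Qed.

Lemma root_truth (K Z : Type) (leK : K -> K -> Prop) (leZ : Z -> Z -> Prop) VK VZ A u rho :
  (forall k, leK k k) -> (forall z, leZ z z) ->
  (forall p, Var p \in subs A -> VZ p rho <-> VK p u) ->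
  (forall z, leZ rho z -> z = rho \/
     forall C, C \in subs A -> forces leK VK u C -> forces leZ VZ z C) ->
  (forall C D, C ~> D \in subs A -> ~ forces leK VK u (C ~> D) ->
     (forces leK VK u C /\ ~ forces leK VK u D) \/
     exists z, [/\ leZ rho z, forces leZ VZ z C & ~ forces leZ VZ z D]) ->
  (forall C, Neg C \in subs A -> ~ forces leK VK u (Neg C) ->
     forces leK VK u C \/ exists2 z, leZ rho z & forces leZ VZ z C) ->
  forall C, C \in subs A -> forces leZ VZ rho C <-> forces leK VK u C.
Proof.
move=> rK rZ hV hz hI hN; elim=> [p|//|C IC D ID|C IC D ID|C IC|C IC D ID] hC.
- exact: hV.
- by have /andP[/IC /= -> /ID ->] := subs_closed hC.
- by have /andP[/IC /= -> /ID ->] := subs_closed hC.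
- have {}IC := IC (subs_closed hC); split=> [h|h z rz].
    apply: contrapT => /(hN _ hC) [/IC|[z rz]]; first exact: h.
    exact: h.
  case: (hz z rz) => [->|/(_ _ hC h)]; last by apply.
  by move=> /IC; apply: h.
- have /andP[/IC {}IC /ID {}ID] := subs_closed hC; split=> [h|h z rz].
    apply: contrapT => /(hI _ _ hC) [[/IC h1]|[z [rz h1]]]; apply.
      by apply/ID/h.
    exact: h.
  case: (hz z rz) => [->|/(_ _ hC h)]; last by apply.
  by move=> /IC hc; apply/ID; apply: h hc.
Qed.

Section Trees.
Variables (L : form -> Prop) (B : finType) (hB : forall s t : B, s = t).
Notation top X := (top_frame hB X).
Notation good := (good L hB).
Hypothesis good_one : good one_frame.
Hypothesis good_S : forall X Y : frame, X -> Y -> good X -> good Y -> good (sum_frame X Y).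
Hypothesis good_P : forall X : frame, X -> good X -> good (plus_frame X).
Variables (K : Type) (le : K -> K -> Prop).
Hypotheses (le_refl : forall k, le k k) (le_trans : forall u v w, le u v -> le v w -> le u w).
Hypothesis le_top : B -> exists t, forall u, le u t.

Section Formula.
Variables (V : var -> K -> Prop) (A : form) (t : B -> K).
Hypothesis hV : upward le V (fun _ => True).
Hypothesis ht : forall b u, le u (t b).

Let lt X := fun x y : top X => fle x y : Prop.

Definition realizes X (VX : var -> top X -> Prop) (x : X) u :=
  forall C, C \in subs A -> forces (@lt X) VX (inl x) C <-> forces le V u C.

Definition tops X (VX : var -> top X -> Prop) :=
  forall p b, VX p (inr b) <-> V p (t b).

(** In a preorder the greatest points may form a cluster; the bisimulation relates the single added
    top to all of it. *)
Lemma forces_top X (VX : var -> top X -> Prop) b C : tops VX ->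
  forces (@lt X) VX (inr b) C <-> forces le V (t b) C.
Proof.
move=> hX; apply: (forces_bisim (E := fun z k => z = inr b /\ le (t b) k)) => //.
- move=> z k [z'|b'] [-> hk] //= _; exists k => //; split=> //.
  by rewrite (hB b b').
- by move=> z k k' [-> hk] kk'; exists (inr b) => //; split=> //; apply: le_trans kk'.
- move=> p z k _ [-> hk]; rewrite hX; split; apply: hV => //; exact: ht.
Qed.

Definition tree_for u := exists (T : frame) (rho : T) (VT : var -> top T -> Prop),
  [/\ good T, forall x, fle rho x, upward (@lt T) VT (fun _ => True), tops VT
    & realizes VT rho u].

Lemma forest_for u E0 s (v : form -> K) :
  (forall E, E \in E0 :: s -> le u (v E) /\ tree_for (v E)) ->
  exists (X : frame) (x0 : X) (VX : var -> top X -> Prop),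
  [/\ good X, upward (@lt X) VX (fun _ => True), tops VX,
      forall E, E \in E0 :: s -> exists x, realizes VX x (v E)
    & forall x C, C \in subs A -> forces le V u C -> forces (@lt X) VX (inl x) C].
Proof.
have pers T (VT : var -> top T -> Prop) rho w x C : upward (@lt T) VT (fun _ => True) ->
    le u w -> realizes VT rho w -> fle rho x -> C \in subs A ->
    forces le V u C -> forces (@lt T) VT (inl x) C.
  move=> upT uw rT rx hC fu.
  apply: (@forces_le _ (@lt T) VT _ C (inl rho)) => //.
  - by move=> a b c; rewrite /lt => ab; apply: fle_trans.
  - by move=> p a b _; apply: upT.
  - by apply/rT => //; apply: forces_le uw fu => // p a b _; apply: hV.
elim: s E0 => [|E1 s IH] E0 hs.
  have [uv [T [rho [VT [gT hrho upT tT rT]]]]] := hs E0 (mem_head _ _).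
  exists T, rho, VT; split=> //.
    by move=> E; rewrite inE => /eqP ->; exists rho.
  by move=> x C; apply: pers rT _.
have [E hE|X [x0 [VX [gX upX tX rX hX]]]] := IH E1.
  by apply: hs; rewrite inE hE orbT.
have [uv [T [rho [VT [gT hrho upT tT rT]]]]] := hs E0 (mem_head _ _).
pose VZ p (z : top (sum_frame T X)) : Prop := match z with
  | inl (inl a) => VT p (inl a) | inl (inr a) => VX p (inl a) | inr b => V p (t b) end.
pose e1 (z : top T) : top (sum_frame T X) := match z with
  | inl a => inl (inl a) | inr b => inr b end.
pose e2 (z : top X) : top (sum_frame T X) := match z with
  | inl a => inl (inr a) | inr b => inr b end.
have f1 C z : forces (@lt _) VT z C <-> forces (@lt _) VZ (e1 z) C.
  apply: forces_map.
  - by case=> [a|a] [b|b].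
  - case=> [a|a] [[b|b]|b] //= h.
    + by exists (inl b).
    + by exists (inr b).
    + by exists (inr b).
  - by move=> p [a|b] _ //=; rewrite tT.
have f2 C z : forces (@lt _) VX z C <-> forces (@lt _) VZ (e2 z) C.
  apply: forces_map.
  - by case=> [a|a] [b|b].
  - case=> [a|a] [[b|b]|b] //= h.
    + by exists (inl b).
    + by exists (inr b).
    + by exists (inr b).
  - by move=> p [a|b] _ //=; rewrite tX.
exists (sum_frame T X), (inl rho), VZ; split=> //.
- exact: good_S.
- move=> p [[a|a]|a] [[b|b]|b] _ //= ab.
  + exact: upT.
  + by move=> h; apply/tT; apply: upT h.
  + exact: upX.
  + by move=> h; apply/tX; apply: upX h.
  + by rewrite (hB a b).
- move=> E; rewrite inE => /orP[/eqP ->|/rX [x hx]].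
    by exists (inl rho) => C hC; rewrite -(f1 C (inl rho)); apply: rT.
  by exists (inr x) => C hC; rewrite -(f2 C (inl x)); apply: hx.
- move=> [x|x] C hC fu.
    by rewrite -(f1 C (inl x)); apply: (pers _ _ _ _ _ _ upT uv rT (hrho x)).
  by rewrite -(f2 C (inl x)); apply: hX.
Qed.

(** Induction on the defect. A failing implication either has a witness of smaller defect, whose
    tree is hung above the new root, or is refuted at a point agreeing with [u] on all subformulas,
    and then [u] refutes it by itself. *)
Lemma tree_forP u : tree_for u.
Proof.
pose d u := defect (subs A) (fun C => forces le V u C).
have [n] := ubnP (d u); elim: n u => // n IH u dn.
pose wit E v := match E with
  | C ~> D => forces le V v C /\ ~ forces le V v D | Neg C => forces le V v C
  | _ => False end.
pose need E := exists v, [/\ le u v, d v < d u & wit E v].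
have [v hv] : {v : form -> K & forall E, need E -> [/\ le u (v E), d (v E) < d u & wit E (v E)]}.
  apply: (@choice _ _ (fun E v => need E -> [/\ le u v, d v < d u & wit E v])) => E.
  by have [[v h]|h] := pselect (need E); [exists v|exists u => /h].
have pers v1 C : le u v1 -> forces le V u C -> forces le V v1 C.
  by move=> uv; apply: forces_le => // p a b _; apply: hV.
have keyI C D : C ~> D \in subs A -> ~ forces le V u (C ~> D) ->
    (forces le V u C /\ ~ forces le V u D) \/ need (C ~> D).
  move=> hE /existsNP [v1 /not_implyP [uv /not_implyP [fC fD]]].
  have [ltd|nlt] := pselect (d v1 < d u); first by right; exists v1.
  have /andP[hC hD] := subs_closed hE; left; split=> [|/(pers _ _ uv)//].
  by apply: (defect_eq (fun C => pers v1 C uv) nlt).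
have keyN C : Neg C \in subs A -> ~ forces le V u (Neg C) ->
    forces le V u C \/ need (Neg C).
  move=> hE /existsNP [v1 /not_implyP [uv /contrapT fC]].
  have [ltd|nlt] := pselect (d v1 < d u); first by right; exists v1.
  by left; apply: (defect_eq (fun C => pers v1 C uv) nlt) => //; apply: (subs_closed hE).
pose s := [seq E <- subs A | `[< need E >]].
have hs E : E \in subs A -> need E -> E \in s.
  by move=> hE /asboolP hn; rewrite mem_filter hn.
have top_ok X (VX : var -> top X -> Prop) b C : tops VX -> forces le V u C ->
    forces (@lt X) VX (inr b) C.
  by move=> tX fu; apply/forces_top => //; apply: pers (ht b u) fu.
(* An empty forest is not a frame, so a root without witnesses is built as a single point. *)
case sE: s hs => [|E0 s'] hs.
  pose VT p (z : top one_frame) : Prop := match z with inl _ => V p u | inr b => V p (t b) end.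
  have tT : tops VT by [].
  exists one_frame, tt, VT; split=> //.
  - move=> p [[]|a] [[]|b] _ //= _; first by apply: hV.
    by rewrite (hB a b).
  apply: root_truth => //.
  - by case=> [[]|] //.
  - by case=> [[]|b] _; [left|right=> C _; apply: top_ok].
  - by move=> C D hE /(keyI _ _ hE) [h|/hs -/(_ hE)]; [left|].
  - by move=> C hE /(keyN _ hE) [h|/hs -/(_ hE)]; [left|].
have [E|X [x0 [VX [gX upX tX rX hX]]]] := @forest_for u E0 s' v.
  rewrite -sE mem_filter => /andP[/asboolP /hv [uv dv _] _]; split=> //.
  by apply: IH; apply: leq_trans dv _.
pose VT p (z : top (plus_frame X)) : Prop := match z with
  | inl None => V p u /\ Var p \in subs A
  | inl (Some x) => VX p (inl x) | inr b => V p (t b) end.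
have tT : tops VT by [].
pose e (z : top X) : top (plus_frame X) := match z with
  | inl a => inl (Some a) | inr b => inr b end.
have fe C z : forces (@lt _) VX z C <-> forces (@lt _) VT (e z) C.
  apply: forces_map.
  - by case=> [a|a] [b|b].
  - case=> [a|a] [[b|]|b] //= h.
    + by exists (inl b).
    + by exists (inr b).
    + by exists (inr b).
  - by move=> p [a|b] _ //=; rewrite tX.
have wz E : E \in subs A -> need E -> exists z : top (plus_frame X), 
    match E with
    | C ~> D => forces (@lt _) VT z C /\ ~ forces (@lt _) VT z D
    | Neg C => forces (@lt _) VT z C
    | _ => True end.
  move=> hE nE; have [x hx] := rX _ (hs _ hE nE); exists (inl (Some x)).
  have [_ _] := hv _ nE; have := subs_closed hE.
  case: E hE {nE hx} (hx) => //= [C|C D] _ hx.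
    by move=> hC; rewrite -(fe C (inl x)) hx.
  by move=> /andP[hC hD]; rewrite -(fe C (inl x)) -(fe D (inl x)) !hx.
exists (plus_frame X), None, VT; split=> //.
- exact: good_P.
- move=> p [[a|]|a] [[b|]|b] _ //= ab.
  + exact: upX.
  + by move=> h; apply/tX; apply: upX h.
  + by move=> [fp hp]; apply: (hX _ (Var p)).
  + by move=> [fp hp]; apply: hV fp.
  + by rewrite (hB a b).
apply: root_truth => //.
- by case=> [[a|]|a] //=; rewrite /lt fle_refl.
- by move=> p hp /=; split=> [[]|].
- case=> [[x|]|b] _; [right=> C hC fu|by left|right=> C _; exact: top_ok].
  by rewrite -(fe C (inl x)); apply: hX.
- move=> C D hE /(keyI _ _ hE) [h|/(wz _ hE) [z [h1 h2]]]; [by left|right].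
  by exists z; split=> //; case: z {h1 h2}.
- move=> C hE /(keyN _ hE) [h|/(wz _ hE) [z h1]]; [by left|right].
  by exists z => //; case: z {h1}.
Qed.

End Formula.

Lemma good_valid : valid L le.
Proof.
move=> A hA V hV u.
have [t ht] : {t : B -> K & forall b u, le u (t b)}.
  by apply: (@choice _ _ (fun b t => forall u, le u t)) => b; apply: le_top.
have [T [rho [VT [gT hrho upT tT rT]]]] := tree_forP A hV ht u.
apply/(rT A (subs_refl A)).
(* The additional root and the spare leaf satisfy no variable; [T] with its top is an upset, so
   truth inside it ignores them. *)
pose VZ p (z : top (plus_frame (sum_frame T one_frame))) : Prop := match z with
  | inl (Some (inl x)) => VT p (inl x) | inr b => VT p (inr b) | _ => False end.
pose e (z : top T) : top (plus_frame (sum_frame T one_frame)) := match z with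
  | inl x => inl (Some (inl x)) | inr b => inr b end.
apply/(@forces_map _ _ _ (fun x y : top (plus_frame (sum_frame T one_frame)) => fle x y)
  VT VZ e A).
- by case=> [a|a] [b|b].
- case=> [a|a] [[[b|[]]|]|b] //= h.
  + by exists (inl b).
  + by exists (inr b).
  + by exists (inr b).
- by move=> p [a|b].
- apply: gT => // p [[[a|[]]|]|a] [[[b|[]]|]|b] _ //= ab; apply: upT => //; exact: ab.
Qed.

End Trees.

(** * Uniform Lyndon interpolants from layered simulations *)

Fixpoint sublists (T : Type) (s : seq T) : seq (seq T) :=
  if s is x :: s' then sublists s' ++ map (cons x) (sublists s') else [:: [::]].

Lemma filter_sublists (T : eqType) (a : pred T) s : filter a s \in sublists s.
Proof.
elim: s => [//|x s IH] /=; rewrite mem_cat; case: (a x); last by rewrite IH.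
by rewrite map_f ?orbT.
Qed.

Lemma sublists_sub (T : eqType) (s c : seq T) : c \in sublists s -> {subset c <= s}.
Proof.
elim: s c => [|x s IH] c /=; first by rewrite inE => /eqP ->.
rewrite mem_cat => /orP[/IH h y /h|/mapP [c' /IH h ->] y]; first by rewrite inE orbC => ->.
by rewrite !inE => /orP[->//|/h ->]; rewrite orbT.
Qed.

Lemma svars_bigor o s p : p \in svars o (bigor s) -> exists2 C, C \in s & p \in svars o C.
Proof.
elim: s => [//|C s IH] /=; rewrite in_fsetU => /orP[h|/IH [D hD h]].
  by exists C; rewrite ?mem_head.
by exists D; rewrite // inE hD orbT.
Qed.

Lemma svars_bigand o s p : p \in svars o (bigand s) -> exists2 C, C \in s & p \in svars o C.
Proof.
elim: s => [//|C s IH] /=; rewrite in_fsetU => /orP[h|/IH [D hD h]].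
  by exists C; rewrite ?mem_head.
by exists D; rewrite // inE hD orbT.
Qed.

Section Layers.
Variables (L : form -> Prop) (hL : intermediate_logic L).
Variable Q : bool -> {fset var}.

(* Formulas of implication depth at most n in the signed vocabulary Q, which is flipped when
   [o] is false; up to equivalence and up to conjunctions and disjunctions these are all. *)
Fixpoint layer n (o : bool) : seq form :=
  match n with
  | 0 => [seq Var p | p <- Q o]
  | n.+1 => layer n o ++
     [seq bigand c ~> bigor d | c <- sublists (layer n (~~ o)), d <- sublists (layer n o)]
  end.

Lemma svars_layer n o C : C \in layer n o ->
  forall o' p, p \in svars o' C -> p \in Q (o' == o).
Proof.
elim: n o C => [|n IH] o C /=.
  by move=> /mapP [q hq ->] [] p //=; rewrite inE => /eqP ->; case: o hq.
rewrite mem_cat => /orP[/IH//|/allpairsP [[c d] /= [/sublists_sub hc /sublists_sub hd ->]]].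
move=> o' p /=; rewrite in_fsetU => /orP[/svars_bigand [D /hc /IH h /h]|/svars_bigor [D /hd /IH h /h //]].
by rewrite -eqb_negLR negbK.
Qed.

(** One implication describes [y']: its premises are the formulas of opposite polarity true at [y'],
    its conclusions those of the given polarity false there. It fails at [y], hence at [x], and a
    successor of [x] refuting it is the match. *)
Lemma layer_back n o (x y y' : world L) :
  (forall C, C \in layer n.+1 o -> x C -> y C) -> wle y y' ->
  exists x', [/\ wle x x', forall C, C \in layer n o -> x' C -> y' C
    & forall C, C \in layer n (~~ o) -> y' C -> x' C].
Proof.
move=> h yy'.
pose c := [seq C <- layer n (~~ o) | `[< y' C >]].
pose d := [seq C <- layer n o | ~~ `[< y' C >]].
have hy : ~ y (bigand c ~> bigor d).
  move=> /yy' /(w_mp (w := y')) h1; have : y' (bigor d).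
    by apply: h1; apply/(w_bigand hL) => C; rewrite mem_filter => /andP[/asboolP].
  by move=> /(w_bigor hL) [C]; rewrite mem_filter => /andP[/asboolP].
have hx : ~ x (bigand c ~> bigor d).
  move=> /h h1; apply: hy; apply: h1; rewrite /= mem_cat; apply/orP; right.
  by apply/allpairsP; exists (c, d); split=> //; apply: filter_sublists.
apply: contrapT => nex; apply: hx; apply/(w_imp hL) => x' xx' /(w_bigand hL) hc.
apply/(w_bigor hL); apply: contrapT => nd; apply: nex; exists x'; split=> // C hC.
- move=> x'C; apply: contrapT => ny; apply: nd; exists C => //.
  by rewrite mem_filter hC andbT; apply/asboolP.
- by move=> y'C; apply: hc; rewrite mem_filter hC andbT; apply/asboolP.
Qed.

Definition sim n (x y : world L) :=
  (forall C, C \in layer n true -> x C -> y C) /\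
  (forall C, C \in layer n false -> y C -> x C).

Lemma sim_back n x y y' : sim n.+1 x y -> wle y y' -> exists2 x', wle x x' & sim n x' y'.
Proof. by move=> [h _] /(layer_back h) [x' [? ? ?]]; exists x'. Qed.

(** The same argument with worlds and polarities exchanged. *)
Lemma sim_forth n x y x' : sim n.+1 x y -> wle x x' -> exists2 y', wle y y' & sim n x' y'.
Proof. by move=> [_ h] /(layer_back h) [y' [? ? ?]]; exists y'. Qed.

Lemma sim_le m n x y : m <= n -> sim n x y -> sim m x y.
Proof.
elim: n => [|n IH]; first by rewrite leqn0 => /eqP ->.
rewrite leq_eqVlt => /orP[/eqP -> //|/IH {}IH [h1 h2]]; apply: IH; split=> C hC.
  by apply: h1; rewrite /= mem_cat hC.
by apply: h2; rewrite /= mem_cat hC.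
Qed.

Lemma sim_atom n x y : sim n x y ->
  (forall p, p \in Q true -> x (Var p) -> y (Var p)) /\
  (forall p, p \in Q false -> y (Var p) -> x (Var p)).
Proof. by move=> /(sim_le (leq0n n)) [h1 h2]; split=> p hp; [apply: h1|apply: h2]; rewrite /= map_f. Qed.

End Layers.

Definition allowed A (P : bool -> {fset var}) o := (svars o A `\` P o)%fset.

Lemma ulip_of_sim L (hL : intermediate_logic L) :
  (forall A P, exists N, forall B (x y : world L),
     (forall o, (svars o B `&` P o = fset0)%fset) -> sim (allowed A P) N x y ->
     x A -> ~ y B -> ~ L (A ~> B)) -> ULIP L.
Proof.
move=> h A P; have [N hN] := h A P; pose Q := allowed A P.
(* Layers are not closed under disjunction, hence a conjunction of disjunctions. The extra level is
   spent by [layer_back] on the trivial step from [y] to itself, which turns a one-sided inclusion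
   into a simulation. *)
pose s := [seq d <- sublists (layer Q N.+1 true) | `[< L (A ~> bigor d) >]].
exists (bigand [seq bigor d | d <- s]); split.
- apply/(logic_impP hL) => w wA; apply/(w_bigand hL) => C /mapP [d].
  by rewrite mem_filter => /andP[/asboolP /(logic_impP hL) hd _] ->; apply: hd.
- move=> o; apply/fsubsetP => p /svars_bigand [C /mapP [d]].
  rewrite mem_filter => /andP[_ /sublists_sub hd] -> /svars_bigor [D /hd /svars_layer hD /hD].
  by case: o.
- move=> B hAB hB; apply/(logic_impP hL) => y /(w_bigand hL) hy; apply: contrapT => nyB.
  pose d := [seq C <- layer Q N.+1 true | ~~ `[< y C >]].
  have : ~ L (A ~> bigor d).
    move=> hd; have : y (bigor d).
      apply: hy; apply/mapP; exists d => //; rewrite mem_filter filter_sublists andbT.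
      exact/asboolP.
    by move=> /(w_bigor hL) [C]; rewrite mem_filter => /andP[/asboolP].
  move=> nd; have [x [xA xd]] : exists x : world L, x A /\ ~ x (bigor d).
    apply: contrapT => nex; apply: nd; apply/(logic_impP hL) => x xA.
    by apply: contrapT => nx; apply: nex; exists x.
  have hxy C : C \in layer Q N.+1 true -> x C -> y C.
    move=> hC xC; apply: contrapT => ny; apply: xd; apply/(w_bigor hL); exists C => //.
    by rewrite mem_filter hC andbT; apply/asboolP.
  have [x' [xx' s1 s2]] := layer_back hL hxy (@wle_refl L y).
  by apply: (hN B x' y hB (conj s1 s2) (xx' _ xA) nyB hAB).
Qed.

Lemma allowedE A P o p : p \in svars o A -> p \notin P o -> p \in allowed A P o.
Proof. by rewrite in_fsetD => -> ->. Qed.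

Lemma disjointE B (P : bool -> {fset var}) o p :
  (forall o, (svars o B `&` P o = fset0)%fset) -> p \in svars o B -> p \notin P o.
Proof.
move=> h hp; apply/negP => hP; have := in_fset0 p.
by rewrite -(h o) in_fsetI hp hP.
Qed.

Lemma signed_amalgam (L : form -> Prop) A B (P : bool -> {fset var}) (Z K1 K2 : Type)
    (leZ : Z -> Z -> Prop) (le1 : K1 -> K1 -> Prop) (le2 : K2 -> K2 -> Prop) V1 V2
    (pi1 : Z -> K1) (pi2 : Z -> K2) z0 :
  (forall o, (svars o B `&` P o = fset0)%fset) ->
  (forall k, le1 k k) -> (forall u v w, le1 u v -> le1 v w -> le1 u w) ->
  (forall k, le2 k k) -> (forall u v w, le2 u v -> le2 v w -> le2 u w) ->
  upward le1 V1 (fun p => p \in vars A) -> upward le2 V2 (fun p => p \in vars B) ->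
  (forall z, leZ z z) -> valid L leZ ->
  (forall z z', leZ z z' -> le1 (pi1 z) (pi1 z')) ->
  (forall z z', leZ z z' -> le2 (pi2 z) (pi2 z')) ->
  (forall z k, le1 (pi1 z) k -> exists z', [/\ leZ z z', le1 (pi1 z') k & le1 k (pi1 z')]) ->
  (forall z k, le2 (pi2 z) k -> exists z', [/\ leZ z z', le2 (pi2 z') k & le2 k (pi2 z')]) ->
  (forall z p, p \in allowed A P true -> V1 p (pi1 z) -> V2 p (pi2 z)) ->
  (forall z p, p \in allowed A P false -> V2 p (pi2 z) -> V1 p (pi1 z)) ->
  forces le1 V1 (pi1 z0) A -> ~ forces le2 V2 (pi2 z0) B -> ~ L (A ~> B).
Proof.
move=> hB r1 t1 r2 t2 up1 up2 rZ vZ m1 m2 b1 b2 at1 at2 fA nfB hAB.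
(* A negative occurrence in [A] could be disturbed only by a variable also negative in [B]; such a
   variable is allowed, so its truth transfers from right to left. Dually for positive occurrences
   in [B]. *)
pose VZ p z := (p \in svars true A /\ V1 p (pi1 z)) \/
  (p \in svars false B /\ V2 p (pi2 z)).
have upZ : upward leZ VZ (fun _ => True).
  move=> p z z' _ zz' [[hp h]|[hp h]]; [left|right]; split=> //.
    by apply: (up1 _ _ _ (svars_vars hp) (m1 _ _ zz')).
  by apply: (up2 _ _ _ (svars_vars hp) (m2 _ _ zz')).
have fZA : forces leZ VZ z0 A.
  apply: (@signed_bisim Z K1 leZ le1 VZ V1 (fun z k => le1 (pi1 z) k /\ le1 k (pi1 z))
    (fun o p => p \in svars o A) _ _ _ _ A true z0 (pi1 z0)) => //.
  - by move=> z k z' [h1 h2] /m1 zz'; exists (pi1 z') => //; apply: t1 zz'.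
  - by move=> z k k' [h1 h2] kk'; have [z' [? ? ?]] := b1 z k' (t1 _ _ _ h1 kk'); exists z'.
  - move=> p z k [h1 h2] hp Vk; left; split=> //; apply: up1 Vk => //; exact: svars_vars hp.
  - move=> p z k [h1 h2] hp VZz; apply: (up1 _ _ _ (svars_vars hp) h1).
    case: VZz => [[//]|[hp' Vz]]; apply: at2 Vz; apply: allowedE => //.
    exact: disjointE hB _.
  - by case.
apply: nfB.
have fZB : forces leZ VZ z0 B := vZ _ hAB VZ upZ z0 z0 (rZ z0) fZA.
apply: (@signed_bisim Z K2 leZ le2 VZ V2 (fun z k => le2 (pi2 z) k /\ le2 k (pi2 z))
    (fun o p => p \in svars (~~ o) B) _ _ _ _ B false z0 (pi2 z0)) fZB => //.
- by move=> z k z' [h1 h2] /m2 zz'; exists (pi2 z') => //; apply: t2 zz'.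
- by move=> z k k' [h1 h2] kk'; have [z' [? ? ?]] := b2 z k' (t2 _ _ _ h1 kk'); exists z'.
- move=> p z k [h1 h2] hp Vk; right; split=> //; apply: up2 Vk => //; exact: svars_vars hp.
- move=> p z k [h1 h2] hp VZz; apply: (up2 _ _ _ (svars_vars hp) h1).
  case: VZz => [[hp' Vz]|[//]]; apply: at1 Vz; apply: allowedE => //.
  exact: disjointE hB _.
- by case.
Qed.

Lemma var_subs o A p : p \in svars o A -> Var p \in subs A.
Proof.
elim: A o => [q|//|A IA B IB|A IA B IB|A IA|A IA B IB] o.
- by case: o; rewrite //= !inE => /eqP ->.
all: rewrite /= ?in_fsetU => h; rewrite inE ?mem_cat; move: h.
all: try (case/orP=> [/IA|/IB] ->; by rewrite !orbT).
by move=> /IA ->; rewrite orbT.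
Qed.

(** * Logics whose frames include all preorders, or all those with a top *)

Section Pitts.
Variables (L : form -> Prop) (hL : intermediate_logic L) (B0 : Type).
Hypothesis can_top : B0 -> forall w : world L, exists t, forall u, wle w u -> wle u t.
Hypothesis all_valid : forall (K : Type) (le : K -> K -> Prop), (forall k, le k k) ->
  (forall u v w, le u v -> le v w -> le u w) -> (B0 -> exists t, forall u, le u t) -> valid L le.

(* Points are pairs (k', m') of worlds; only the theory of k' within the subformulas of A
   matters. The slack 2d+2 in the simulation, d the number of subformulas false at k', pays for
   each growth of that theory. *)
Lemma ulip_of_all_valid : ULIP L.
Proof.
apply: ulip_of_sim => // A P.
(* [2 * d + 3] is needed at any pair; two more levels pay for the greatest pair, reached by one step
   to the right and one step back. *)
exists (2 * size (subs A) + 5) => B x y hB sxy xA nyB hAB.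
pose Q := allowed A P.
pose d (k : world L) := defect (subs A) k.
pose th (k k' : world L) := forall C, C \in subs A -> k C -> k' C.
have dsz k : d k <= size (subs A) by apply: count_size.
have thd k k' : th k k' -> th k' k -> d k = d k'.
  move=> h1 h2; apply: eq_in_count => C hC; congr negb.
  by apply/asboolP/asboolP; [apply: h1|apply: h2].
(* The pair [k], [m] is an anchor. While the theory on the left does not grow, the right component
   may climb repeatedly: its partners are found from the anchor each time, so no level is lost. One
   step leaves [2 * d + 2], a second [2 * d + 1], which is [2 * (d - 1) + 3]: enough for a new
   anchor after a growth. *)
pose ok (z : world L * world L) := [/\ wle x z.1, wle y z.2 & exists k m,
  [/\ th k z.1, th z.1 k, wle x k, wle m z.2 & sim Q (2 * d z.1 + 3) k m
     /\ sim Q (2 * d z.1 + 2) z.1 z.2]].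
have ok_triv k m : wle x k -> wle y m -> sim Q (2 * d k + 3) k m -> ok (k, m).
  move=> xk ym s; split=> //=; exists k, m; split=> //; split=> //.
  by apply: sim_le s; rewrite leq_add2l.
pose Z := {z | ok z}.
(* Theories are compared on the left because a new left component is found above the anchor, not
   above the current component. *)
pose leZ (z z' : Z) := th (sval z).1 (sval z').1 /\ wle (sval z).2 (sval z').2.
have leZ_refl z : leZ z z by split=> // C.
have leZ_trans u v w : leZ u v -> leZ v w -> leZ u w.
  move=> [h1 h2] [h3 h4]; split=> [C hC /(h1 _ hC) /(h3 _ hC) //|]; exact: wle_trans h4.
have vZ : valid L leZ.
  apply: all_valid => // b.
  have [tx htx] := can_top b x; have [ty hty] := can_top b y.
  have xtx : wle x tx by exact: htx.
  have yty : wle y ty by exact: hty.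
  have [m ym s1] : exists2 m, wle y m & sim Q (2 * size (subs A) + 4) tx m.
    by apply: sim_forth xtx => //; apply: sim_le sxy; rewrite -addnS.
  have [k xk s2] : exists2 k, wle tx k & sim Q (2 * size (subs A) + 3) k ty.
    apply: (@sim_back L hL Q _ tx m) => //; first by rewrite -addnS.
    exact: hty.
  (* The world found on the way back is equivalent to the greatest one, so it may be replaced by
     it. *)
  have ktx : wle k tx := htx k (wle_trans xtx xk).
  have s3 : sim Q (2 * size (subs A) + 3) tx ty.
    by case: s2 => h1 h2; split=> C hC; [move=> /xk; apply: h1|move=> /(h2 _ hC) /ktx].
  have okt : ok (tx, ty).
    by apply: ok_triv => //; apply: sim_le s3; rewrite leq_add2r leq_mul2l dsz.
  exists (exist _ _ okt) => -[[k' m'] z_ok]; have [/= xk' ym' _] := z_ok; split=> /=.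
    by move=> C _; apply: (htx k' xk').
  exact: (hty m' ym').
pose VZ p (z : Z) := (p \in svars true A /\ (sval z).1 (Var p)) \/
  (p \in svars false B /\ (sval z).2 (Var p)).
have upZ : upward leZ VZ (fun _ => True).
  move=> p z z' _ [z1 z2] [[hp h]|[hp h]]; [left|right]; split=> //; last exact: z2.
  by apply: z1 => //; apply: var_subs hp.
have atoms (z : Z) : (forall p, p \in Q true -> (sval z).1 (Var p) -> (sval z).2 (Var p)) /\
    (forall p, p \in Q false -> (sval z).2 (Var p) -> (sval z).1 (Var p)).
  by have [_ _ [k [m [_ _ _ _ [_ /sim_atom]]]]] := svalP z.
have ext (z : Z) k : wle (sval z).1 k -> d k < d (sval z).1 ->
    exists2 z', leZ z z' & (sval z').1 = k.
  case: z => [[k0 m0] /= z_ok] k0k ltd; have [/= xk0 ym0 [k1 [m1 [_ _ _ _ [_ s]]]]] := z_ok.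
  have [m m0m s'] : exists2 m, wle m0 m & sim Q (2 * d k0 + 1) k m.
    by apply: (@sim_forth L hL Q _ k0) k0k; rewrite -addnS.
  have okm : ok (k, m).
    apply: ok_triv; [exact: wle_trans k0k|exact: wle_trans m0m|apply: sim_le s'; lia].
  by exists (exist _ _ okm) => //; split=> //= C _; apply: k0k.
(* The first projection is not a p-morphism: [ext] lifts only steps that lower the defect. For the
   other steps [defect_eq] moves the refutation back to the point itself. *)
have sgn C : forall (o : bool) (z : Z), C \in subs A ->
    (forall o' p, p \in svars o' C -> p \in svars (o' == o) A) ->
    if o then (sval z).1 C -> forces leZ VZ z C else forces leZ VZ z C -> (sval z).1 C.
  elim: C => [p|//|C IC D ID|C IC D ID|C IC|C IC D ID] o z hC hs.
  - have := hs true p; rewrite /= inE eqxx => /(_ isT).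
    case: o {hs} => hp /=; first by left.
    case=> [[//]|[hp' h]]; apply: (proj2 (atoms z)) h; apply: allowedE => //.
    exact: disjointE hB _.
  - by case: o {hs} => //= /w_bot.
  - have /andP[sC sD] := subs_closed hC.
    have {}IC := IC o z sC (fun o' p h => hs o' p (fsubsetP (fsubsetUl _ _) p h)).
    have {}ID := ID o z sD (fun o' p h => hs o' p (fsubsetP (fsubsetUr _ _) p h)).
    by case: o {hs} IC ID => IC ID /=; rewrite (w_and hL) => -[/IC ? /ID ?].
  - have /andP[sC sD] := subs_closed hC.
    have {}IC := IC o z sC (fun o' p h => hs o' p (fsubsetP (fsubsetUl _ _) p h)).
    have {}ID := ID o z sD (fun o' p h => hs o' p (fsubsetP (fsubsetUr _ _) p h)).
    by case: o {hs} IC ID => IC ID /=; rewrite (w_or hL) => -[/IC|/ID] ?; tauto.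
  - have sC := subs_closed hC.
    have {}hs o' p : p \in svars o' C -> p \in svars (o' == ~~ o) A.
      by move=> hp; have := hs (~~ o') p; rewrite /= negbK -eqb_negLR; apply.
    case: o hs => hs /=.
      move=> h z' [z1 _] /(IC false z' sC hs) hz'.
      by move/(w_neg hL): (z1 _ hC h) => /(_ _ (@wle_refl L _)); apply.
    move=> h; apply: contrapT => /(w_neg hL) /existsNP [k /not_implyP [zk /contrapT kC]].
    have [ltd|nlt] := pselect (d k < d (sval z).1).
      have [z' zz' ez'] := ext z k zk ltd.
      by apply: (h z' zz'); apply: (IC true z' sC hs); rewrite ez'.
    apply: (h z (leZ_refl z)); apply: (IC true z sC hs).
    exact: (defect_eq zk nlt).
  - have /andP[sC sD] := subs_closed hC.
    have hsC o' p : p \in svars o' C -> p \in svars (o' == ~~ o) A.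
      move=> hp; have := hs (~~ o') p; rewrite /= negbK -eqb_negLR in_fsetU hp; exact.
    have hsD o' p h := hs o' p (fsubsetP (fsubsetUr _ _) p h).
    case: o hs hsC hsD => hs hsC hsD /=.
      move=> h z' [z1 _] /(IC false z' sC hsC) hz'; apply: (ID true z' sD hsD).
      exact: w_mp (z1 _ hC h) hz'.
    move=> h; apply: contrapT => /(w_imp hL) /existsNP [k /not_implyP [zk /not_implyP [kC kD]]].
    have [ltd|nlt] := pselect (d k < d (sval z).1).
      have [z' zz' ez'] := ext z k zk ltd; apply: kD; rewrite -ez'.
      apply: (ID false z' sD hsD); apply: (h z' zz'); apply: (IC true z' sC hsC).
      by rewrite ez'.
    apply: kD; apply: (zk); apply: (ID false z sD hsD); apply: (h z (leZ_refl z)).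
    apply: (IC true z sC hsC); exact: (defect_eq zk nlt).
have ok0 : ok (x, y).
  by apply: ok_triv => //; apply: sim_le sxy; have := dsz x; lia.
pose z0 : Z := exist _ _ ok0.
have fZA : forces leZ VZ z0 A.
  by apply: (sgn A true z0 (subs_refl A)) => // -[].
have fZB : forces leZ VZ z0 B := vZ _ hAB VZ upZ z0 z0 (leZ_refl z0) fZA.
apply: nyB; apply/(forces_can hL).
apply: (@signed_bisim Z (world L) leZ (@wle L) VZ (@canV L) (fun z k => (sval z).2 = k)
    (fun o p => p \in svars (~~ o) B) _ _ _ _ B false z0 y) fZB => //.
- by move=> z k z' <- [_ h]; exists (sval z').2.
- move=> [[k' m'] z_ok] k m'' /= <- m'm''.
  have [/= xk' ym' [k0 [m0 [t1 t2 xk0 m0m' [s1 s2]]]]] := z_ok.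
  have dk := thd _ _ t1 t2.
  have [k'' k0k'' s3] : exists2 k'', wle k0 k'' & sim Q (2 * d k' + 2) k'' m''.
    by apply: (@sim_back L hL Q _ k0 m0); [rewrite -addnS|exact: wle_trans m'm''].
  have t3 : th k' k'' by move=> C hC /(t2 _ hC); apply: k0k''.
  have [ltd|nlt] := pselect (d k'' < d k0).
    have okk : ok (k'', m'').
      apply: ok_triv; [exact: wle_trans k0k''|exact: wle_trans m'm''|apply: sim_le s3; lia].
    by exists (exist _ _ okk).
  have t4 : th k'' k0 by apply: (defect_eq k0k'' nlt).
  have t5 : th k0 k'' by move=> C _; apply: k0k''.
  have dk'' := thd _ _ t5 t4.
  (* The theory on the left has not grown, so the old anchor serves the new pair. *)
  have okk : ok (k'', m'').
    split=> /=; [exact: wle_trans k0k''|exact: wle_trans m'm''|].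
    exists k0, m0; split=> //; first exact: wle_trans m'm''.
    by rewrite -dk'' dk.
  by exists (exist _ _ okk).
- by move=> p z k <- hp h; right.
- move=> p z k <- hp [[hp' h]|[_ //]]; apply: (proj1 (atoms z)) h; apply: allowedE => //.
  exact: disjointE hB _.
- by case.
Qed.

End Pitts.

(** * Chains *)

Lemma ex_max_nat (T : Type) (P : T -> Prop) (c : T -> nat) n x :
  P x -> (forall y, P y -> c y <= n) -> exists2 y, P y & forall z, P z -> c z <= c y.
Proof.
move=> Px bound; have [k] := ubnP (n - c x); elim: k x Px => // k IH x Px lt.
have [h|/existsNP [y /not_implyP [Py /negP ncy]]] := pselect (forall z, P z -> c z <= c x).
  by exists x.
by apply: (IH y Py); have := bound y Py; have := bound x Px; lia.
Qed.

Lemma ex_min_nat (T : Type) (P : T -> Prop) (c : T -> nat) x :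
  P x -> exists2 y, P y & forall z, P z -> c y <= c z.
Proof.
move=> Px; have [k] := ubnP (c x); elim: k x Px => // k IH x Px lt.
have [h|/existsNP [y /not_implyP [Py /negP ncy]]] := pselect (forall z, P z -> c x <= c z).
  by exists x.
by apply: (IH y Py); lia.
Qed.

Definition height (Z : Type) (vs : seq var) (V : var -> Z -> Prop) (z : Z) :=
  count (fun p => `[< V p z >]) vs.

(** Looking at finitely many variables only leaves finitely many classes, so extremal points of a
    chain exist and [height] finds them. *)
Definition coarse (Z : Type) (vs : seq var) (V : var -> Z -> Prop) z z' :=
  forall p, p \in vs -> V p z -> V p z'.

Lemma height_size (Z : Type) vs (V : var -> Z -> Prop) z : height vs V z <= size vs.
Proof. exact: count_size. Qed.

Lemma height_mono (Z : Type) vs (V : var -> Z -> Prop) z z' :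
  coarse vs V z z' -> height vs V z <= height vs V z'.
Proof.
rewrite /height; elim: vs => [//|p s IH] h /=.
apply: leq_add; last by apply: IH => q hq; apply: h; rewrite inE hq orbT.
case: asboolP => //= hp; suff -> : `[< V p z' >] by [].
by apply/asboolP; apply: h; rewrite ?mem_head.
Qed.

Lemma height_inj (Z : Type) vs (V : var -> Z -> Prop) z z' :
  coarse vs V z z' -> height vs V z' <= height vs V z -> coarse vs V z' z.
Proof.
elim: vs => [//|p s IH] h /= hc.
have h' : coarse s V z z' by move=> q hq; apply: h; rewrite inE hq orbT.
have hp : V p z -> V p z' by apply: h; rewrite mem_head.
have := height_mono h'; move: hc; rewrite /height /= -!/(height _ _ _) => hc hs.
move=> q; rewrite inE => /orP[/eqP ->|hq].
  by move=> /asboolP hq; apply: contrapT => /asboolPn /negbTE hn; move: hc; rewrite hq hn; lia.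
apply: IH => //; move: hc; case: (asboolP (V p z)) => [/hp h0|_]; last by lia.
by have -> : `[< V p z' >] by [apply/asboolP]; lia.
Qed.

Definition ord_frame (n : nat) : frame.
Proof.
refine (@Frame 'I_n.+1 (fun i j => i <= j) _ _ _).
- by move=> i; exact: leqnn.
- by move=> i j k; exact: leq_trans.
- by move=> i j /anti_leq h; exact: val_inj.
Defined.

Lemma void_irrelevant (s t : void) : s = t. Proof. by case: s. Qed.

Lemma top_void L X : fvalid L (top_frame void_irrelevant X) <-> fvalid L X.
Proof.
split.
- apply: (@valid_pmorph L _ _ _ _ (fun a : top_frame void_irrelevant X =>
    match a with inl x => x | inr b => match b with end end)).
  + by case=> [x|[]] [y|[]].
  + by case=> [x|[]] y xy; exists (inl y).
  + by move=> x; exists (inl x).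
- apply: (@valid_pmorph L _ _ _ _ (fun x : X => inl x : top_frame void_irrelevant X)).
  + by [].
  + by move=> x [y|[]] xy; exists y.
  + by case=> [x|[]]; exists x.
Qed.

Lemma ord_valid L (hL : intermediate_logic L) (cip : CIP L) :
  fvalid L three_chain -> forall n, fvalid L (ord_frame n).
Proof.
(* The spare bottom is the root that [step_plus] splits; at the end it is merged into the least
   element. *)
move=> h3 n; suff h : fvalid L (plus_frame (ord_frame n)).
  apply: (@valid_pmorph L _ _ _ _ (fun a : plus_frame (ord_frame n) =>
    if a is Some i then i else ord0 : ord_frame n)) h.
  - by case=> [i|] [j|].
  - by case=> [i|] j //= ij; exists (Some j).
  - by move=> i; exists (Some i).
elim: n => [|n IH].
  apply: (@valid_pmorph L three_chain _ _ _ (fun a : three_chain =>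
    if a is Some _ then Some ord0 else None : plus_frame (ord_frame 0))) h3.
  - by case=> [[[]|]|] [[[]|]|].
  - case=> [[[]|]|] [[[] // i]|] //= _.
    + by exists (Some (Some tt)) => //; congr Some; apply: val_inj.
    + by exists (Some (Some tt)) => //; congr Some; apply: val_inj.
    + by exists (Some (Some tt)) => //; congr Some; apply: val_inj.
    + by exists None.
  - case=> [[[] // i]|]; last by exists None.
    by exists (Some None); congr Some; apply: val_inj.
have /top_void h : fvalid L (top_frame void_irrelevant (plus_frame (plus_frame (ord_frame n)))).
  by apply: step_plus => //; [exact: (ord0 : 'I_n.+1)|apply/top_void|apply/top_void].
apply: (@valid_pmorph L _ _ _ _ (fun a : plus_frame (plus_frame (ord_frame n)) =>
   match a with Some (Some i) => Some (lift ord0 i) | Some None => Some ord0 | None => None end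
   : plus_frame (ord_frame n.+1))) h.
- by case=> [[i|]|] [[j|]|].
- case=> [[i|]|] [j|] //=.
  + move=> ij; have [k jE|j0] := unliftP ord0 j; last by rewrite j0 in ij.
    by exists (Some (Some k)); rewrite ?jE //=; move: ij; rewrite jE.
  + by move=> _; have [k ->|->] := unliftP ord0 j; [exists (Some (Some k))|exists (Some None)].
  + by move=> _; have [k ->|->] := unliftP ord0 j; [exists (Some (Some k))|exists (Some None)].
  + by exists None.
- case=> [j|]; last by exists None.
  by have [k ->|->] := unliftP ord0 j; [exists (Some (Some k))|exists (Some None)].
Qed.

Lemma chain_valid L (Z : Type) (le : Z -> Z -> Prop) :
  (forall n, fvalid L (ord_frame n)) -> (forall z, le z z) ->
  (forall u v w, le u v -> le v w -> le u w) -> (forall u v, le u v \/ le v u) -> valid L le.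
Proof.
move=> hord le_refl le_trans le_total A hA V hV z.
pose vs : seq var := vars A; pose c := height vs V; pose n := size vs.
have cle a b : le a b -> coarse vs V a b by move=> ab p _; apply: hV.
(* Stage [j] is matched with the highest points above [z] having at most [j] true variables. The
   maximum with [c z] makes [z] itself a candidate at every stage, so no stage is empty. *)
pose E (j : ord_frame n) k := [/\ le z k, c k <= maxn j (c z)
  & forall k', le z k' -> c k' <= maxn j (c z) -> c k' <= c k].
have exE j : exists k, E j k.
  have [//||k [zk ck] hk] := @ex_max_nat Z (fun k => le z k /\ c k <= maxn j (c z)) c n z.
  - by split=> //; apply: leq_maxr.
  - by move=> k _; apply: height_size.
  - by exists k; split=> // k' h1 h2; apply: hk.
have forth j k j' : E j k -> fle j j' -> exists2 k', le k k' & E j' k'.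
  move=> [zk ck hk] jj'; have [k' [zk' ck' hk']] := exE j'.
  have [kk'|k'k] := le_total k k'; first by exists k'.
  exists k => //; split=> //; first by move: ck jj'; rewrite /=; lia.
  by move=> k'' h1 h2; apply: leq_trans (hk' _ h1 h2) (height_mono (cle _ _ k'k)).
have same j k k' p : E j k -> E j k' -> p \in vs -> V p k -> V p k'.
  move=> [zk ck hk] [zk' ck' hk'] hp; have [kk'|k'k] := le_total k k'; first exact: cle.
  by apply: (height_inj (cle _ _ k'k)) => //; apply: hk'.
pose V' p j := p \in vs /\ exists2 k, E j k & V p k.
have E0 : exists2 j, E j z & True.
  have lt : c z < n.+1 by rewrite ltnS; apply: height_size.
  exists (Ordinal lt) => //; split=> //=; first by rewrite leq_max leqnn.
  by move=> k' _; rewrite maxnn.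
case: E0 => j0 hj0 _.
apply/(@forces_bisim (ord_frame n) Z (fun a b => fle a b) le V' V E A _ _ _ j0 z hj0) => //.
- move=> j k k' [zk ck hk] kk'.
  have lt : maxn j (c k') < n.+1 by rewrite gtn_max ltn_ord ltnS height_size.
  exists (Ordinal lt); first by rewrite /= leq_maxl.
  have ckk' := height_mono (cle _ _ kk').
  split=> /=; [exact: le_trans kk'|by rewrite !leq_max leqnn orbT|].
  move=> k'' zk'' h; have hz := height_mono (cle _ _ zk).
  rewrite -/c in ckk' hz; have [le1|gt1] := leqP (c k'') (maxn j (c z)).
    by apply: leq_trans ckk'; apply: hk.
  by move: h gt1; lia.
- move=> p j k hp hE; split; first by move=> [_ [k' hE' Vp]]; apply: same hE' hE hp Vp.
  by move=> Vp; split=> //; exists k.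
- apply: hord => // p j j' _ jj' [hp [k hE Vp]]; split=> //.
  by have [k' kk' hE'] := forth _ _ _ hE jj'; exists k' => //; apply: hV Vp.
Qed.

(** If the coarse order puts [v] above [u] and [wle] does not, then [v] is below [u] by linearity.
    Whatever holds at [v] then holds at [u], and formulas over [vs] persist from [u] back to [v]
    along the coarse order. *)
Lemma coarse_forces L (hL : intermediate_logic L) (vs : seq var) (w : world L) C :
  (forall u v, wle w u -> wle w v -> wle u v \/ wle v u) -> {subset vars C <= vs} ->
  forall u : {u | wle w u},
  forces (fun a b : {u | wle w u} => coarse vs (@canV L) (sval a) (sval b))
    (fun p a => canV p (sval a)) u C <-> sval u C.
Proof.
move=> lin.
have le_co (a b : world L) : wle a b -> coarse vs (@canV L) a b by move=> ab p _; apply: ab.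
set co := fun _ _ => _; set V := fun _ _ => _.
have co_trans a b c : co a b -> co b c -> co a c.
  by move=> h1 h2 p hp /(h1 _ hp) /(h2 _ hp).
have upV D : {subset vars D <= vs} -> upward co V (fun p => p \in vars D).
  by move=> hD p a b /hD hp; apply.
elim: C => [p|//|A IA B IB|A IA B IB|A IA|A IA B IB] hs u /=.
- by [].
- by split=> // /w_bot.
- have sA : {subset vars A <= vs} by move=> p hp; apply: hs; rewrite in_fsetU hp.
  have sB : {subset vars B <= vs} by move=> p hp; apply: hs; rewrite in_fsetU hp orbT.
  by rewrite (w_and hL) IA // IB.
- have sA : {subset vars A <= vs} by move=> p hp; apply: hs; rewrite in_fsetU hp.
  have sB : {subset vars B <= vs} by move=> p hp; apply: hs; rewrite in_fsetU hp orbT.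
  by rewrite (w_or hL) IA // IB.
- rewrite (w_neg hL); split=> [h v uv vA|h v uv /(IA hs) vA].
    have wv := wle_trans (svalP u) uv.
    by apply: (h (exist _ v wv)); [exact: le_co|apply/IA].
  have [uv'|vu] := lin _ _ (svalP u) (svalP v); first exact: h uv' vA.
  by apply: (h _ (@wle_refl L _)); apply: vu.
- have sA : {subset vars A <= vs} by move=> p hp; apply: hs; rewrite in_fsetU hp.
  have sB : {subset vars B <= vs} by move=> p hp; apply: hs; rewrite in_fsetU hp orbT.
  rewrite (w_imp hL); split=> [h v uv vA|h v uv /(IA sA) vA].
    have wv := wle_trans (svalP u) uv.
    by apply/(IB sB (exist _ v wv)); apply: h; [exact: le_co|apply/(IA sA)].
  have [uv'|vu] := lin _ _ (svalP u) (svalP v); first by apply/(IB sB); exact: h uv' vA.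
  apply: (@forces_le _ co V co_trans B u) => //; first exact: upV.
  by apply/(IB sB); apply: (h _ (@wle_refl L _)); apply: vu.
Qed.

(* Two chains are merged into one: a point of the second lies above a point of the first as
   soon as it has all its atoms in the positive common vocabulary. *)
Lemma ulip_of_linear L (hL : intermediate_logic L) :
  (forall w u v : world L, wle w u -> wle w v -> wle u v \/ wle v u) ->
  (forall n, fvalid L (ord_frame n)) -> ULIP L.
Proof.
(* Level 1 suffices: each world of either chain needs a partner on atoms only. *)
move=> lin hord; apply: ulip_of_sim => // A P; exists 1 => B x y hB sxy xA nyB.
pose Q := allowed A P; pose vs : seq var := (vars A `|` vars B)%fset.
pose K1 := {u : world L | wle x u}; pose K2 := {u : world L | wle y u}.
pose co (u v : world L) := coarse vs (@canV L) u v.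
have sA : {subset vars A <= vs} by move=> p hp; rewrite in_fsetU hp.
have sB : {subset vars B <= vs} by move=> p hp; rewrite in_fsetU hp orbT.
have sQ o : {subset Q o <= vs}.
  by move=> p; rewrite in_fsetD => /andP[_ /svars_vars /sA].
have co_refl u : co u u by [].
have co_trans u v w : co u v -> co v w -> co u w.
  by move=> h1 h2 p hp /(h1 _ hp) /(h2 _ hp).
have co_total w u v : wle w u -> wle w v -> co u v \/ co v u.
  by move=> wu wv; have [h|h] := lin _ _ _ wu wv; [left|right] => p _; apply: h.
pose U (u v : world L) := forall p, p \in Q true -> u (Var p) -> v (Var p).
pose D (u v : world L) := forall p, p \in Q false -> v (Var p) -> u (Var p).
have U_l u u' v : co u u' -> U u' v -> U u v.
  by move=> uu' h p hp /(uu' _ (sQ _ _ hp)); apply: h.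
have U_r u v v' : co v v' -> U u v -> U u v'.
  by move=> vv' h p hp /(h _ hp) /(vv' _ (sQ _ _ hp)).
(* [m2 u] is a least point of the second chain allowed above [u]. It satisfies [D] because the
   simulation supplies a point with both [U] and [D], and [m2 u] lies below that one. Dually, [m1 v]
   is a greatest point allowed below [v]. *)
have [m2 hm2] : {m2 : K1 -> K2 & forall u, [/\ U (sval u) (sval (m2 u)), D (sval u) (sval (m2 u))
    & forall v : K2, U (sval u) (sval v) -> co (sval (m2 u)) (sval v)]}.
  apply: (@choice _ _ (fun (u : K1) (m : K2) => [/\ U (sval u) (sval m), D (sval u) (sval m)
    & forall v : K2, U (sval u) (sval v) -> co (sval m) (sval v)])) => u.
  have [v yv /sim_atom [a1 a2]] := sim_forth hL sxy (svalP u).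
  have [m Um minm] := @ex_min_nat K2 (fun v => U (sval u) (sval v))
    (fun v => height vs (@canV L) (sval v)) (exist _ v yv) a1.
  have hm (v' : K2) : U (sval u) (sval v') -> co (sval m) (sval v').
    move=> /minm hc; have [//|h] := co_total _ _ _ (svalP m) (svalP v').
    exact: height_inj.
  exists m; split=> // p hp /(hm (exist _ v yv) a1 _ (sQ _ _ hp)); exact: a2.
have [m1 hm1] : {m1 : K2 -> K1 & forall v, [/\ U (sval (m1 v)) (sval v), D (sval (m1 v)) (sval v)
    & forall u : K1, U (sval u) (sval v) -> co (sval u) (sval (m1 v))]}.
  apply: (@choice _ _ (fun (v : K2) (m : K1) => [/\ U (sval m) (sval v), D (sval m) (sval v)
    & forall u : K1, U (sval u) (sval v) -> co (sval u) (sval m)])) => v.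
  have [u xu /sim_atom [a1 a2]] := sim_back hL sxy (svalP v).
  have [|m Um maxm] := @ex_max_nat K1 (fun u => U (sval u) (sval v))
    (fun u => height vs (@canV L) (sval u)) (size vs) (exist _ u xu) a1.
    by move=> u' _; apply: height_size.
  have hm (u' : K1) : U (sval u') (sval v) -> co (sval u') (sval m).
    move=> /maxm hc; have [//|h] := co_total _ _ _ (svalP u') (svalP m).
    exact: height_inj.
  exists m; split=> // p hp /(a2 _ hp) h; exact: (hm (exist _ u xu) a1 _ (sQ _ _ hp)).
pose leZ (a b : K1 + K2) := match a, b with
  | inl u, inl u' => co (sval u) (sval u')
  | inr v, inr v' => co (sval v) (sval v')
  | inl u, inr v => U (sval u) (sval v)
  | inr v, inl u => ~ U (sval u) (sval v) end.
have tot1 (u u' : K1) := co_total _ _ _ (svalP u) (svalP u').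
have tot2 (v v' : K2) := co_total _ _ _ (svalP v) (svalP v').
have vZ : valid L leZ.
  apply: chain_valid => //.
  - by case=> a; apply: co_refl.
  - move=> [a|a] [b|b] [c|c] //=.
    + exact: co_trans.
    + exact: U_l.
    + by move=> h1 h2; have [//|/U_l h] := tot1 a c; case: h2; apply: h.
    + by move=> h1 h2; apply: U_r h1.
    + by move=> h1 h2 h; apply: h1; apply: U_l h.
    + by move=> h1 h2; have [//|h] := tot2 a c; case: h1; apply: U_r h2.
    + by move=> h1 h2 h; apply: h2; apply: U_r h.
    + exact: co_trans.
  - move=> [a|a] [b|b] /=.
    + exact: tot1.
    + exact: EM.
    + by rewrite or_comm; exact: EM.
    + exact: tot2.
pose pi1 (a : K1 + K2) := match a with inl u => u | inr v => m1 v end.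
pose pi2 (a : K1 + K2) := match a with inl u => m2 u | inr v => v end.
pose x0 : K1 := exist _ x (@wle_refl L x); pose y0 : K2 := exist _ y (@wle_refl L y).
apply: (@signed_amalgam L A B P (K1 + K2)%type K1 K2 leZ
  (fun a b => co (sval a) (sval b)) (fun a b => co (sval a) (sval b))
  (fun p a => canV p (sval a)) (fun p a => canV p (sval a)) pi1 pi2 (inl x0)) => //.
- by move=> u v w; apply: co_trans.
- by move=> u v w; apply: co_trans.
- by move=> p u v /sA hp; apply.
- by move=> p u v /sB hp; apply.
- by case=> a; apply: co_refl.
- move=> [a|a] [b|b] //= h.
  + by have [_ _] := hm1 b; apply.
  + have [h1 _ _] := hm1 a; have [//|h2] := tot1 (m1 a) b.
    by case: h; apply: U_l h1.
  + by have [h1 _ _] := hm1 a; have [_ _] := hm1 b; apply; apply: U_r h1.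
- move=> [a|a] [b|b] //= h.
  + by have [h1 _ _] := hm2 b; have [_ _] := hm2 a; apply; apply: U_l h1.
  + by have [_ _] := hm2 a; apply.
  + have [h1 _ _] := hm2 b; have [//|h2] := tot2 a (m2 b).
    by case: h; apply: U_r h1.
- move=> [a|a] k /= h; first by exists (inl k).
  have [_ _ h1] := hm1 a.
  by have [/h1 h2|h2] := pselect (U (sval k) (sval a)); [exists (inr a)|exists (inl k)].
- move=> [a|a] k /= h; last by exists (inr k).
  by exists (inr k); split=> //=; have [h1 _ _] := hm2 a; apply: U_r h1.
- move=> [a|a] p hp /=; first by have [h _ _] := hm2 a; apply: h.
  by have [h _ _] := hm1 a; apply: h.
- move=> [a|a] p hp /=; first by have [_ h _] := hm2 a; apply: h.
  by have [_ h _] := hm1 a; apply: h.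
- exact/(coarse_forces hL (lin x) sA).
(* The root is sent to [m2 x0], which may lie below [y]; if [B] held there it would persist to
   [y]. *)
- move=> /= hf; apply: nyB; apply/(coarse_forces hL (lin y) sB y0).
  apply: forces_le hf.
  + by move=> u v w; apply: co_trans.
  + by move=> p u v /sB hp; apply.
  + by have [_ _] := hm2 x0; apply; have [a1 _] := sim_atom sxy.
Qed.

(** * Excluded frames *)

Lemma unit_irrelevant (s t : unit) : s = t. Proof. by case: s t => [] []. Qed.

Notation three_fork := (plus_frame (sum_frame two_points one_frame)).
Notation diamond := (top_frame unit_irrelevant fork).

Section Excluded.
Variables (L : form -> Prop) (hL : intermediate_logic L).

Lemma fvalid_definable (Y : frame) (w0 : world L) (k : world L -> Y) :
  (forall y, exists phi, forall u : world L, wle w0 u -> u phi <-> fle y (k u)) ->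
  (forall u z, wle w0 u -> fle (k u) z -> exists2 v, wle u v & k v = z) ->
  (forall z, fle (k w0) z) -> fvalid L Y.
Proof.
move=> /choice [phi hphi] back root.
apply: (@valid_definable L hL Y _ w0 k) => //.
- move=> u v wu uv; apply/hphi; first exact: wle_trans uv.
  by apply: uv; apply/hphi => //; apply: fle_refl.
move=> S upS; exists (bigor [seq phi y | y <- enum Y & `[< S y >]]) => u wu.
rewrite (w_bigor hL); split.
  move=> [C /mapP [y]]; rewrite mem_filter => /andP[/asboolP Sy _] -> /hphi -/(_ wu) h.
  exact: upS Sy.
move=> Sk; exists (phi (k u)); last by apply/hphi => //; apply: fle_refl.
by apply/mapP; exists (k u); rewrite // mem_filter mem_enum andbT; apply/asboolP.
Qed.

Definition maximal (u : world L) := forall v, wle u v -> wle v u.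

Lemma w_top (w : world L) : w (Neg Bot).
Proof. by apply/(w_neg hL) => u _ /w_bot. Qed.

Lemma w_dense (u : world L) p : exists2 v, wle u v & v (Or p (Neg p)).
Proof.
have [|h] := pselect (u (Neg p)).
  by move=> h; exists u => //; apply/(w_or hL); right.
have /existsNP [v /not_implyP [uv /contrapT vp]] := fun g => h ((w_neg hL u p).2 g).
by exists v => //; apply/(w_or hL); left.
Qed.

Lemma maximal_neg (m : world L) p : maximal m -> ~ m p -> m (Neg p).
Proof. by move=> hm np; apply/(w_neg hL) => v /hm vm /vm. Qed.

(** A formula [p] gained above [w] makes [Or p (Neg p)] fail at [w], while it can be reached from
    every world; its truth maps the cone of [w] onto the chain. *)
Lemma no_two_chain : ~ fvalid L two_chain -> forall w, maximal w.
Proof.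
move=> nv w v wv; apply: contrapT => /existsNP [p /not_implyP [vp nwp]]; apply: nv.
pose x := Or p (Neg p).
have nwx : ~ w x.
  by move=> /(w_or hL) [//|/(w_neg hL) /(_ v wv)].
apply: (@fvalid_definable two_chain w (fun u => if `[< u x >] then Some tt else None)).
- case=> [[]|]; [exists x|exists (Neg Bot)] => u wu; last by split=> // _; apply: w_top.
  by case: asboolP.
- move=> u z wu; case: asboolP => ux; case: z => [[]|] //= _.
  + by exists u => //; case: asboolP.
  + have [t ut tx] := w_dense u p; exists t => //; by case: asboolP.
  + by exists u => //; case: asboolP.
- by case: asboolP.
Qed.

(** [y] is the formula that bounds the depth by two, with [x] as its inner part. If [q] and then [p]
    are gained strictly, their upsets are the upper two levels of a three-element chain. *)
Lemma no_three_chain : ~ fvalid L three_chain ->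
  forall w u v : world L, wle w u -> wle u v -> wle u w \/ wle v u.
Proof.
move=> nv w u v wu uv; apply: contrapT => /not_orP[].
move=> /existsNP [q /not_implyP [uq nwq]] /existsNP [p /not_implyP [vp nup]]; apply: nv.
pose x := Or p (Neg p); pose y := Or q (q ~> x).
have nwy : ~ w y.
  move=> /(w_or hL) [//|/(w_imp hL) /(_ u wu uq) /(w_or hL) [//|/(w_neg hL) /(_ v uv)]].
  by apply.
have xy (t : world L) : t x -> t y.
  by move=> tx; apply/(w_or hL); right; apply/(w_imp hL) => t' tt' _; apply: tt'.
apply: (@fvalid_definable three_chain w (fun u => if `[< u x >] then Some (Some tt)
  else if `[< u y >] then Some None else None)).
- case=> [[[]|]|]; [exists x|exists y|exists (Neg Bot)] => t wt.
  + by split=> [/asboolP -> //|]; case: asboolP => // _; case: asboolP.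
  + case: asboolP => tx; first by split=> // _; apply: xy.
    by case: asboolP.
  + by split=> // _; apply: w_top.
- move=> t z wt.
  have up : exists2 t', wle t t' & (if `[< t' x >] then Some (Some tt)
    else if `[< t' y >] then Some None else None : three_chain) = Some (Some tt).
    by have [t' tt' tx'] := w_dense t p; exists t' => //; case: asboolP.
  case: asboolP => tx; first by case: z => [[[]|]|].
  case: asboolP => ty; case: z => [[[]|]|] //= _.
  + by exists t => //; case: asboolP => // _; case: asboolP.
  + have : ~ t (q ~> x) by move=> h; apply: ty; apply/(w_or hL); right.
    move=> /(w_imp hL) /existsNP [t' /not_implyP [tt' /not_implyP [tq tx']]].
    exists t' => //; case: asboolP => // _; case: asboolP => // ny; case: ny.
    by apply/(w_or hL); left.
  + by exists t => //; case: asboolP => // _; case: asboolP.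
- by case: asboolP => [/xy //|_]; case: asboolP.
Qed.

Lemma no_fork : ~ fvalid L fork -> forall (w : world L) p, w (Neg p) \/ w (Neg (Neg p)).
Proof.
move=> nv w p; apply: contrapT => /not_orP[n1 n2]; apply: nv.
pose k (u : world L) : fork := if `[< u (Neg p) >] then Some (inl tt)
  else if `[< u (Neg (Neg p)) >] then Some (inr tt) else None.
have disj (u : world L) : u (Neg p) -> u (Neg (Neg p)) -> False.
  by move=> h1 /(w_neg hL) /(_ u (@wle_refl L u)); apply.
have k1 (u : world L) : u (Neg p) -> k u = Some (inl tt) by rewrite /k; case: asboolP.
have k2 (u : world L) : u (Neg (Neg p)) -> k u = Some (inr tt).
  by move=> h; rewrite /k; case: asboolP => [/disj /(_ h)//|_]; case: asboolP.
have k3 (u : world L) : ~ u (Neg p) -> ~ u (Neg (Neg p)) -> k u = None.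
  by move=> h1 h2; rewrite /k; case: asboolP => // _; case: asboolP.
apply: (@fvalid_definable fork w k); last by rewrite k3.
- case=> [[[]|[]]|]; [exists (Neg p)|exists (Neg (Neg p))|exists (Neg Bot)] => u wu.
  + by split=> [/k1 -> //|]; rewrite /k; case: asboolP => // _; case: asboolP.
  + split=> [/k2 -> //|]; rewrite /k; case: asboolP => // _; case: asboolP => //.
  + by split=> // _; apply: w_top.
- move=> u z wu.
  have [h1|h1] := pselect (u (Neg p)).
    by rewrite k1 //; case: z => [[[]|[]]|] // _; exists u; rewrite // k1.
  have [h2|h2] := pselect (u (Neg (Neg p))).
    by rewrite k2 //; case: z => [[[]|[]]|] // _; exists u; rewrite // k2.
  case: z => [[[]|[]]|] _.
  + move/(w_neg hL): h2 => /existsNP [v /not_implyP [uv /contrapT h]].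
    by exists v => //; rewrite k1.
  + move/(w_neg hL): h1 => /existsNP [v /not_implyP [uv /contrapT h]].
    exists v => //; rewrite k2 //; apply/(w_neg hL) => t vt /(w_neg hL) /(_ t (@wle_refl L t)).
    by apply; apply: vt.
  + by exists u => //; rewrite k3.
Qed.

Section Wem.
Hypothesis wem : forall (w : world L) p, w (Neg p) \/ w (Neg (Neg p)).

(** By weak excluded middle the formulas whose double negation is in [w] form a prime theory, and
    everything true somewhere above [w] is among them. *)
Lemma wem_top (w : world L) : exists t, forall u, wle w u -> wle u t.
Proof.
have nn (u : world L) p : u (Neg (Neg p)) <-> ~ u (Neg p).
  split; first by move=> /(w_neg hL) /(_ u (@wle_refl L u)).
  by case: (wem u p).
have nup (u : world L) p : wle w u -> u p -> w (Neg (Neg p)).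
  by move=> wu hp; apply/nn => /(w_neg hL) /(_ u wu).
have pt : prime_theory L (fun p => w (Neg (Neg p))).
  split.
  - by move=> A hA; apply: (nup w) => //; apply: w_logic.
  - move=> A B hAB hA; apply/nn => hB; move/(w_neg hL): hA.
    have [v wv vAB] : exists2 v, wle w v & v (A ~> B).
      move/nn/(w_neg hL): hAB => /existsNP [v /not_implyP [wv /contrapT h]].
      by exists v.
    move=> /(_ v wv) /(w_neg hL) /existsNP [t /not_implyP [vt /contrapT tA]].
    have wt := wle_trans wv vt.
    move/(w_neg hL): hB => /(_ t wt); apply.
    exact: w_mp (vt _ vAB) tA.
  - by move=> /nn; apply; apply: w_top.
  - move=> A B /nn h; have [hA|] := wem w A; last by left.
    have [hB|] := wem w B; last by right.
    case: h; apply/(w_neg hL) => u wu /(w_or hL) [].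
      by move/(w_neg hL): hA; apply.
    by move/(w_neg hL): hB; apply.
by exists (World pt) => u wu p up; apply: nup up.
Qed.

(** The two implications between [p] and [q] mark the sides of the diamond and their conjunction its
    top. Weak excluded middle makes the top reachable: neither [Neg p] nor [Neg q] can hold above
    [w]. *)
Lemma no_diamond : ~ fvalid L diamond ->
  forall w u v : world L, wle w u -> wle w v -> wle u v \/ wle v u.
Proof.
move=> nv w u v wu wv; apply: contrapT => /not_orP[].
move=> /existsNP [p /not_implyP [up nvp]] /existsNP [q /not_implyP [vq nuq]]; apply: nv.
pose a := p ~> q; pose b := q ~> p.
have wna : ~ w a by move=> /(w_imp hL) /(_ u wu up).
have wnb : ~ w b by move=> /(w_imp hL) /(_ v wv vq).
have aq (t : world L) : t q -> t a by move=> tq; apply/(w_imp hL) => t' tt' _; apply: tt'.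
have bp (t : world L) : t p -> t b by move=> tp; apply/(w_imp hL) => t' tt' _; apply: tt'.
have dense (t : world L) : wle w t -> exists2 t', wle t t' & t' a /\ t' b.
  move=> wt; have : ~ t (Neg p).
    have [/(w_neg hL) /(_ u wu) //|/(w_neg hL) h] := wem w p.
    exact: h.
  move=> /(w_neg hL) /existsNP [t1 /not_implyP [tt1 /contrapT t1p]].
  have : ~ t1 (Neg q).
    have [/(w_neg hL) /(_ v wv) //|/(w_neg hL) h] := wem w q.
    by apply: h; apply: wle_trans tt1.
  move=> /(w_neg hL) /existsNP [t2 /not_implyP [t12 /contrapT t2q]].
  exists t2; first exact: wle_trans t12.
  by split; [apply: aq|apply: bp; apply: t12].
pose k (t : world L) : diamond := if `[< t a >] then
  (if `[< t b >] then inr tt else inl (Some (inl tt)))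
  else if `[< t b >] then inl (Some (inr tt)) else inl None.
have k11 (t : world L) : t a -> t b -> k t = inr tt by move=> /asboolP h1 /asboolP h2; rewrite /k h1 h2.
have k10 (t : world L) : t a -> ~ t b -> k t = inl (Some (inl tt)).
  by move=> /asboolP h1 /asboolPn/negbTE h2; rewrite /k h1 h2.
have k01 (t : world L) : ~ t a -> t b -> k t = inl (Some (inr tt)).
  by move=> /asboolPn/negbTE h1 /asboolP h2; rewrite /k h1 h2.
have k00 (t : world L) : ~ t a -> ~ t b -> k t = inl None.
  by move=> /asboolPn/negbTE h1 /asboolPn/negbTE h2; rewrite /k h1 h2.
apply: (@fvalid_definable diamond w k); last by rewrite k00 // => -[].
- case=> [[[[]|[]]|]|[]]; [exists a|exists b|exists (Neg Bot)|exists (And a b)] => t wt.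
  + by rewrite /k; case: asboolP => h1; case: asboolP => h2.
  + by rewrite /k; case: asboolP => h1; case: asboolP => h2.
  + by split=> [_|_]; [rewrite /k; case: asboolP => h1; case: asboolP|apply: w_top].
  + by rewrite (w_and hL) /k; case: asboolP => h1; case: asboolP => h2; split=> // -[].
- move=> t z wt; have [t' tt' [ta' tb']] := dense t wt.
  have top : exists2 t', wle t t' & k t' = inr tt by exists t' => //; rewrite k11.
  have [h1|h1] := pselect (t a); have [h2|h2] := pselect (t b).
  + by rewrite k11 //; case: z => [z|[]].
  + by rewrite k10 //; case: z => [[[[]|[]]|]|[]] // _; exists t; rewrite // k10.
  + by rewrite k01 //; case: z => [[[[]|[]]|]|[]] // _; exists t; rewrite // k01.
  + case: z => [[[[]|[]]|]|[]] // _; last by exists t; rewrite // k00.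
    * move/(w_imp hL): h2 => /existsNP [t1 /not_implyP [tt1 /not_implyP [tq tp]]].
      exists t1 => //; rewrite k10 //; first exact: aq.
      by move=> /(w_imp hL) /(_ t1 (@wle_refl L t1) tq).
    * move/(w_imp hL): h1 => /existsNP [t1 /not_implyP [tt1 /not_implyP [tp tq]]].
      exists t1 => //; rewrite k01 //; last exact: bp.
      by move=> /(w_imp hL) /(_ t1 (@wle_refl L t1) tp).
Qed.

End Wem.

Section Depth.
Hypothesis depth : forall w u v : world L, wle w u -> wle u v -> wle u w \/ wle v u.

Lemma max_or (w u : world L) : wle w u -> wle u w \/ maximal u.
Proof.
move=> wu; have [|h] := pselect (wle u w); [by left|right=> v uv].
by have [] := depth wu uv.
Qed.

Lemma max_above (w : world L) : exists2 m, wle w m & maximal m.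
Proof.
have [h|/existsNP [u /not_implyP [wu nu]]] := pselect (maximal w); first by exists w.
by exists u => //; have [] := max_or wu.
Qed.

(** Maximal worlds decide [p] and [q], so they fall into three classes, one for each of the given
    worlds. By the depth bound any other world above [x] is equivalent to [x] and sees all three. *)
Lemma no_three_fork : ~ fvalid L three_fork -> forall x m1 m2 m3 : world L,
  wle x m1 -> wle x m2 -> wle x m3 -> maximal m1 -> maximal m2 -> maximal m3 ->
  [\/ wle m1 m2, wle m1 m3 | wle m2 m3].
Proof.
move=> nv x m1 m2 m3 x1 x2 x3 M1 M2 M3; apply: contrapT => no3; apply: nv.
have n12 : ~ wle m1 m2 by move=> h; apply: no3; constructor 1.
have n13 : ~ wle m1 m3 by move=> h; apply: no3; constructor 2.
have n23 : ~ wle m2 m3 by move=> h; apply: no3; constructor 3.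
have n21 : ~ wle m2 m1 by move=> /M2.
move: n12 n13 n23 n21 => /existsNP [f12 /not_implyP [a12 b12]] /existsNP [f13 /not_implyP [a13 b13]].
move=> /existsNP [f23 /not_implyP [a23 b23]] /existsNP [f21 /not_implyP [a21 b21]].
pose p := And f12 f13; pose q := And f21 f23.
have p1 : m1 p by apply/(w_and hL).
have p2 : ~ m2 p by move=> /(w_and hL) [].
have p3 : ~ m3 p by move=> /(w_and hL) [].
have q2 : m2 q by apply/(w_and hL).
have q3 : ~ m3 q by move=> /(w_and hL) [].
pose A2 := And (Neg p) q; pose A3 := And (Neg p) (Neg q).
have d12 (u : world L) : u p -> u A2 -> False.
  by move=> up /(w_and hL) [/(w_neg hL) /(_ u (@wle_refl L u))].
have d13 (u : world L) : u p -> u A3 -> False.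
  by move=> up /(w_and hL) [/(w_neg hL) /(_ u (@wle_refl L u))].
have d23 (u : world L) : u A2 -> u A3 -> False.
  by move=> /(w_and hL) [_ uq] /(w_and hL) [_ /(w_neg hL) /(_ u (@wle_refl L u))].
have h2 : m2 A2 by apply/(w_and hL); split=> //; apply: maximal_neg.
have h3 : m3 A3 by apply/(w_and hL); split; apply: maximal_neg.
pose k (u : world L) : three_fork := if `[< u p >] then Some (inl (inl tt))
  else if `[< u A2 >] then Some (inl (inr tt))
  else if `[< u A3 >] then Some (inr tt) else None.
have k1 (u : world L) : u p -> k u = Some (inl (inl tt)) by rewrite /k; case: asboolP.
have k2 (u : world L) : u A2 -> k u = Some (inl (inr tt)).
  by move=> h; rewrite /k; case: asboolP => [/d12 /(_ h)//|_]; case: asboolP.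
have k3 (u : world L) : u A3 -> k u = Some (inr tt).
  move=> h; rewrite /k; case: asboolP => [/d13 /(_ h)//|_].
  by case: asboolP => [/d23 /(_ h)//|_]; case: asboolP.
have k4 (u : world L) : ~ u p -> ~ u A2 -> ~ u A3 -> k u = None.
  by rewrite /k => *; do 3 case: asboolP => //.
have kx : k x = None.
  apply: k4; first by move=> /x2.
    by move=> /x1 /(d12 _ p1).
  by move=> /x1 /(d13 _ p1).
have kmax (u : world L) : maximal u -> k u <> None.
  move=> hu; have [/k1 ->//|np] := pselect (u p); have up := maximal_neg hu np.
  have [uq|nq] := pselect (u q); first by rewrite k2 //; apply/(w_and hL).
  by rewrite k3 //; apply/(w_and hL); split=> //; apply: maximal_neg.
apply: (@fvalid_definable three_fork x k); last by rewrite kx.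
- case=> [[[[]|[]]|[]]|]; [exists p|exists A2|exists A3|exists (Neg Bot)] => u xu.
  + split=> [/k1 ->//|]; rewrite /k; case: asboolP => // _; do 2 case: asboolP => //.
  + split=> [/k2 ->//|]; rewrite /k; case: asboolP => // _; do 2 case: asboolP => //.
  + split=> [/k3 ->//|]; rewrite /k; case: asboolP => // _; do 2 case: asboolP => //.
  + by split=> // _; apply: w_top.
- move=> u z xu; case ku: (k u) => [c|].
    by case: z => [d|] //= h; exists u; rewrite // ku; congr Some;
      case: c d h {ku} => [[[]|[]]|[]] [[[]|[]]|[]].
  have ux : wle u x by have [//|/kmax] := max_or xu.
  case: z => [[[[]|[]]|[]]|] _.
  + by exists m1; [exact: wle_trans x1|rewrite k1].
  + by exists m2; [exact: wle_trans x2|rewrite k2].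
  + by exists m3; [exact: wle_trans x3|rewrite k3].
  + by exists u.
Qed.

End Depth.

End Excluded.

(** * Logics of depth two *)

Definition fork_le (I : Type) (a b : option I) :=
  match a, b with
  | None, _ => True
  | Some i, Some j => i = j
  | Some _, None => False
  end.

Fixpoint points n : frame :=
  if n is n'.+1 then sum_frame one_frame (points n') else one_frame.

Lemma points_discrete n (c d : points n) : fle c d -> c = d.
Proof.
elim: n c d => [|n IH]; first by case=> [] [].
by case=> [[]|c] [[]|d] //= /IH ->.
Qed.

Lemma points_point n : points n.
Proof. by case: n => [|n]; [exact: tt|exact: (inl tt)]. Qed.

Lemma points_union (I : Type) n1 n2 (f1 : points n1 -> I) (f2 : points n2 -> I) :
  exists n (f : points n -> I), (forall c, exists d, f d = f1 c) /\
    (forall c, exists d, f d = f2 c) /\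
    (forall d, (exists c, f d = f1 c) \/ (exists c, f d = f2 c)).
Proof.
elim: n1 f1 => [|n1 IH] f1.
  exists n2.+1, (fun a : points n2.+1 => match a with inl _ => f1 tt | inr c => f2 c end).
  split; [|split].
  - by case; exists (inl tt).
  - by move=> c; exists (inr c).
  - by case=> [[]|c]; [left; exists tt|right; exists c].
have [n [f [h1 [h2 h3]]]] := IH (fun c => f1 (inr c)).
exists n.+1, (fun a : points n.+1 => match a with inl _ => f1 (inl tt) | inr c => f c end).
split; [|split].
- by case=> [[]|c]; [exists (inl tt)|have [d <-] := h1 c; exists (inr d)].
- by move=> c; have [d <-] := h2 c; exists (inr d).
- case=> [[]|d]; first by left; exists (inl tt).
  by case: (h3 d) => -[c hc]; [left; exists (inr c)|right; exists c].
Qed.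

Lemma points_types (I : Type) (V : var -> I -> Prop) (vs : seq var) (D : I -> Prop) i0 :
  D i0 -> exists n (f : points n -> I), (forall c, D (f c)) /\
    forall i, D i -> exists c, forall p, p \in vs -> V p i <-> V p (f c).
Proof.
elim: vs D i0 => [|p vs IH] D i0 Di0.
  by exists 0, (fun _ => i0); split=> // i _; exists tt.
have ext i j : (V p i <-> V p j) -> (forall q, q \in vs -> V q i <-> V q j) ->
    forall q, q \in p :: vs -> V q i <-> V q j.
  by move=> h1 h2 q; rewrite inE => /orP[/eqP ->|/h2].
have one (b : bool) : (forall i, D i -> `[< V p i >] = b) ->
    exists n (f : points n -> I), (forall c, D (f c)) /\
    forall i, D i -> exists c, forall q, q \in p :: vs -> V q i <-> V q (f c).
  move=> hb; have [n [f [h1 h2]]] := IH D i0 Di0.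
  exists n, f; split=> // i Di; have [c hc] := h2 i Di; exists c; apply: ext => //.
  have := hb i Di; have := hb _ (h1 c); rewrite -{1}(hb i Di) => e _.
  by split=> /asboolP h; apply/asboolP; rewrite ?e // -e.
have [[i1 [D1 V1]]|n1] := pselect (exists i, D i /\ V p i); last first.
  by apply: (one false) => i Di; apply/asboolP => Vi; apply: n1; exists i.
have [[i2 [D2 V2]]|n2] := pselect (exists i, D i /\ ~ V p i); last first.
  by apply: (one true) => i Di; apply/asboolP; apply: contrapT => Vi; apply: n2; exists i.
have [m1 [f1 [a1 b1]]] := IH (fun i => D i /\ V p i) i1 (conj D1 V1).
have [m2 [f2 [a2 b2]]] := IH (fun i => D i /\ ~ V p i) i2 (conj D2 V2).
have [n [f [h1 [h2 h3]]]] := points_union f1 f2.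
exists n, f; split.
  by move=> d; case: (h3 d) => -[c ->]; [have [] := a1 c|have [] := a2 c].
move=> i Di; have [Vi|Vi] := pselect (V p i).
  have [c hc] := b1 i (conj Di Vi); have [d hd] := h1 c; exists d; rewrite hd.
  by apply: ext => //; have [_ ?] := a1 c.
have [c hc] := b2 i (conj Di Vi); have [d hd] := h2 c; exists d; rewrite hd.
by apply: ext => //; have [_ ?] := a2 c.
Qed.

(** The variables of [A] distinguish only finitely many kinds of leaves, and finite forks of every
    size come from three leaves by repeated unions. *)
Lemma fork_valid L (hL : intermediate_logic L) (cip : CIP L) (I : Type) (i0 : I) :
  fvalid L fork -> fvalid L three_fork -> valid L (@fork_le I).
Proof.
move=> v2 v3 A hA V hV z.
have g1 : good L void_irrelevant one_frame by apply/top_void.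
have g2 : good L void_irrelevant two_points by apply/top_void.
have gn n : good L void_irrelevant (points n).
  by elim: n => [//|n IH]; apply: (good_sum hL cip (tt : one_frame) (points_point n)).
have vn n : fvalid L (plus_frame (points n.+1)).
  by apply/top_void; apply: (step_sum hL cip (tt : one_frame) (points_point n)).
have [n [f [_ hf]]] := @points_types I (fun p i => V p (Some i)) (vars A) (fun _ => True) i0 Logic.I.
(* The leaf beyond those needed duplicates [i0]; it is there because [step_sum] joins two nonempty
   parts. *)
pose g (c : points n.+1) : I := match c with inl _ => i0 | inr c => f c end.
pose E (a : plus_frame (points n.+1)) (b : option I) : Prop := match a, b with
  | None, None => True
  | Some c, Some i => forall p, p \in vars A -> V p (Some i) <-> V p (Some (g c))
  | _, _ => False end.
pose VZ p (a : plus_frame (points n.+1)) := V p (omap g a).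
have [a ha] : exists a, E a z.
  case: z => [i|]; last by exists None.
  by have [c hc] := hf i Logic.I; exists (Some (inr c)).
apply/(@forces_bisim _ _ (fun a b : plus_frame (points n.+1) => fle a b) (@fork_le I) VZ V E A _ _ _ a) => //.
- case=> [c|] [i|] [c'|] //= h.
  + by move=> /(@points_discrete n.+1) <-; exists (Some i).
  + by move=> _; exists (Some (g c')).
  + by exists None.
- case=> [c|] [i|] [j|] //= h.
  + by move=> <-; exists (Some c) => //=; apply: (@fle_refl (points n.+1)).
  + by have [c hc] := hf j Logic.I; exists (Some (inr c)).
  + by exists None.
- by move=> p [c|] [i|] hp //= h; rewrite /VZ /= h.
- apply: vn => // p [c|] [d|] _ //= h; rewrite /VZ /=; last by apply: hV.
  by have /= <- := @points_discrete n.+1 _ _ h.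
Qed.

Section DepthTwo.
Variables (L : form -> Prop) (hL : intermediate_logic L).
Hypothesis depth : forall w u v : world L, wle w u -> wle u v -> wle u w \/ wle v u.

(** Two levels: one to follow [u], one to return from a maximal world above its partner. The return
    ends above the maximal [u], hence at [u] up to equivalence. *)
Lemma sim_max1 Q (x y u : world L) : sim Q 2 x y -> wle x u -> maximal u ->
  exists v, [/\ wle y v, maximal v & sim Q 0 u v].
Proof.
move=> s xu mu; have [v yv s1] := sim_forth hL s xu.
have [m vm mm] := max_above depth v; have [u' uu' [h1 h2]] := sim_back hL s1 vm.
exists m; split=> //; first exact: wle_trans vm.
by split=> C hC; [move=> /uu'; apply: h1|move=> /(h2 _ hC); apply: mu].
Qed.

Lemma sim_max2 Q (x y v : world L) : sim Q 2 x y -> wle y v -> maximal v ->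
  exists u, [/\ wle x u, maximal u & sim Q 0 u v].
Proof.
move=> s yv mv; have [u xu s1] := sim_back hL s yv.
have [m um mm] := max_above depth u; have [v' vv' [h1 h2]] := sim_forth hL s1 um.
exists m; split=> //; first exact: wle_trans um.
by split=> C hC; [move=> /(h1 _ hC); apply: mv|move=> /vv'; apply: h2].
Qed.

(** In depth two a world above the root is maximal or equivalent to the root, so the glued frame is
    a fork whose leaves are pairs of maximal worlds agreeing on atoms. *)
Lemma ulip_of_forks :
  (forall Q (x y : world L), sim Q 2 x y -> exists (I : Type) (px py : I -> world L),
    [/\ valid L (@fork_le I),
        forall i, [/\ wle x (px i), wle y (py i), maximal (px i), maximal (py i)
                    & sim Q 0 (px i) (py i)],
        forall u, wle x u -> maximal u -> wle u x \/ exists i, wle u (px i)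
      & forall v, wle y v -> maximal v -> wle v y \/ exists i, wle v (py i)]) -> ULIP L.
Proof.
move=> hI; apply: ulip_of_sim => // A P; exists 2 => B x y hB sxy xA nyB.
have [I [px [py [vI hi cx cy]]]] := hI _ _ _ sxy.
pose pi1 (a : option I) := if a is Some i then px i else x.
pose pi2 (a : option I) := if a is Some i then py i else y.
apply: (@signed_amalgam L A B P (option I) (world L) (world L) (@fork_le I) (@wle L) (@wle L)
  (@canV L) (@canV L) pi1 pi2 None) => //.
- exact: wle_refl.
- by move=> u v w; apply: wle_trans.
- exact: wle_refl.
- by move=> u v w; apply: wle_trans.
- by move=> p u v _; apply.
- by move=> p u v _; apply.
- by case.
- by case=> [i|] [j|] //= h; [rewrite h; apply: wle_refl|have [] := hi j|apply: wle_refl].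
- by case=> [i|] [j|] //= h; [rewrite h; apply: wle_refl|have [] := hi j|apply: wle_refl].
- case=> [i|] k /= h.
    by exists (Some i); split=> //=; have [_ _ + _ _] := hi i; apply.
  have [kx|mk] := max_or depth h; first by exists None.
  have [kx|[i ki]] := cx k h mk; first by exists None.
  by exists (Some i); split=> //; apply: mk.
- case=> [i|] k /= h.
    by exists (Some i); split=> //=; have [_ _ _ + _] := hi i; apply.
  have [kx|mk] := max_or depth h; first by exists None.
  have [kx|[i ki]] := cy k h mk; first by exists None.
  by exists (Some i); split=> //; apply: mk.
- case=> [i|] p hp /=; last by apply: (proj1 (sim_atom sxy)).
  by have [_ _ _ _ s] := hi i; apply: (proj1 (sim_atom s)).
- case=> [i|] p hp /=; last by apply: (proj2 (sim_atom sxy)).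
  by have [_ _ _ _ s] := hi i; apply: (proj2 (sim_atom s)).
- exact/forces_can.
- by move=> /(forces_can hL).
Qed.

Lemma two_cover (x : world L) : ~ fvalid L three_fork ->
  exists a b : world L, [/\ wle x a, wle x b, maximal a, maximal b
    & forall m, wle x m -> maximal m -> wle m a \/ wle m b].
Proof.
move=> n3; have [a xa ma] := max_above depth x.
have [h|/existsNP [b /not_implyP [xb /not_implyP [mb nba]]]] :=
  pselect (forall m, wle x m -> maximal m -> wle m a).
  by exists a, a; split=> // m xm mm; left; apply: h.
exists a, b; split=> // m xm mm.
have := no_three_fork hL depth n3 xa xb xm ma mb mm.
by case=> h; [case: nba; apply: ma|left; apply: ma|right; apply: mb].
Qed.

Lemma ulip_of_depth_two (cip : CIP L) : ULIP L.
Proof.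
have [v1|n1] := pselect (fvalid L two_chain); last first.
  have hm := no_two_chain hL n1.
  apply: ulip_of_forks => Q x y s.
  exists void, (fun i : void => match i with end), (fun i : void => match i with end); split=> //.
  - apply: (@valid_definable L hL _ _ x (fun _ => None)) => //.
    + by move=> u [[]|] _ _; exists u.
    + move=> S _; have [h|h] := pselect (S None); [exists (Neg Bot)|exists Bot] => u _.
        by split=> // _; apply: w_top.
      by split=> // /w_bot.
  - by move=> u xu _; left; apply: hm.
  - by move=> u xu _; left; apply: hm.
have [v2|n2] := pselect (fvalid L fork); last first.
  have wem := no_fork hL n2; apply: ulip_of_forks => Q x y s.
  (* A greatest world exists above [x] and above [y], so one pair of maximal worlds covers both
     sides. *)
  have [t ht] := wem_top hL wem x; have [m xm mm] := max_above depth x.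
  have [v [yv mv s0]] := sim_max1 s xm mm; have [t' ht'] := wem_top hL wem y.
  exists unit, (fun _ => m), (fun _ => v); split=> //.
  - apply: (@valid_pmorph L _ _ _ _ (fun a : two_chain => a : option unit)) v1.
    + by case=> [[]|] [[]|].
    + by case=> [[]|] [[]|] // _; [exists (Some tt)|exists (Some tt)|exists None].
    + by case=> [[]|]; [exists (Some tt)|exists None].
  - move=> u xu mu; right; exists tt; apply: wle_trans (ht _ xu) _.
    by apply: mm; apply: ht.
  - move=> u yu mu; right; exists tt; apply: wle_trans (ht' _ yu) _.
    by apply: mv; apply: ht'.
have [v3|n3] := pselect (fvalid L three_fork); apply: ulip_of_forks => Q x y s.
  (* Forks of any size are available, so every matching pair can be a leaf. *)
  pose I := {uv : world L * world L | [/\ wle x uv.1, wle y uv.2, maximal uv.1, maximal uv.2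
    & sim Q 0 uv.1 uv.2]}.
  exists I, (fun i => (sval i).1), (fun i => (sval i).2).
  have mk u v : wle x u -> wle y v -> maximal u -> maximal v -> sim Q 0 u v ->
    exists i : I, sval i = (u, v).
    by move=> h1 h2 h3 h4 h5; exists (exist _ (u, v) (And5 h1 h2 h3 h4 h5)).
  have [m xm mm] := max_above depth x; have [v [yv mv s0]] := sim_max1 s xm mm.
  have [i0 _] := mk _ _ xm yv mm mv s0.
  split.
  - exact: fork_valid.
  - by case.
  - move=> u xu mu; right; have [v' [yv' mv' s']] := sim_max1 s xu mu.
    by have [i ei] := mk _ _ xu yv' mu mv' s'; exists i; rewrite ei.
  - move=> u yu mu; right; have [v' [yv' mv' s']] := sim_max2 s yu mu.
    by have [i ei] := mk _ _ yv' yu mv' mu s'; exists i; rewrite ei.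
(* Only two leaves are available now, so two pairs have to cover the maximal worlds on both
   sides. *)
have [a1 [a2 [xa1 xa2 ma1 ma2 ca]]] := two_cover x n3.
have [b1 [b2 [yb1 yb2 mb1 mb2 cb]]] := two_cover y n3.
have part1 a : wle x a -> maximal a -> sim Q 0 a b1 \/ sim Q 0 a b2.
  move=> xa ma; have [v [yv mv [h1 h2]]] := sim_max1 s xa ma.
  have [vb|vb] := cb v yv mv; [left|right]; split=> C hC.
  - by move=> /(h1 _ hC) /vb.
  - by move=> /(mv _ vb) /(h2 _ hC).
  - by move=> /(h1 _ hC) /vb.
  - by move=> /(mv _ vb) /(h2 _ hC).
have part2 b : wle y b -> maximal b -> sim Q 0 a1 b \/ sim Q 0 a2 b.
  move=> yb mb; have [u [xu mu [h1 h2]]] := sim_max2 s yb mb.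
  have [ua|ua] := ca u xu mu; [left|right]; split=> C hC.
  - by move=> /(mu _ ua) /(h1 _ hC).
  - by move=> /(h2 _ hC) /ua.
  - by move=> /(mu _ ua) /(h1 _ hC).
  - by move=> /(h2 _ hC) /ua.
have vb : valid L (@fork_le bool).
  apply: (@valid_pmorph L _ _ _ _ (fun a : fork => match a with
    | Some (inl _) => Some true | Some (inr _) => Some false | None => None end : option bool)) v2.
  - by case=> [[[]|[]]|] [[[]|[]]|].
  - case=> [[[]|[]]|] [[]|] //= _.
    + by exists (Some (inl tt)).
    + by exists (Some (inr tt)).
    + by exists (Some (inl tt)).
    + by exists (Some (inr tt)).
    + by exists None.
  - by case=> [[]|]; [exists (Some (inl tt))|exists (Some (inr tt))|exists None].
(* A total and surjective relation between two pairs contains a perfect matching. *)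
have matching : (sim Q 0 a1 b1 /\ sim Q 0 a2 b2) \/ (sim Q 0 a1 b2 /\ sim Q 0 a2 b1).
  have := part1 _ xa1 ma1; have := part1 _ xa2 ma2.
  have := part2 _ yb1 mb1; have := part2 _ yb2 mb2; tauto.
have cover (b b' : world L) : (forall m, wle y m -> maximal m -> wle m b \/ wle m b') ->
    wle y b -> wle y b' -> maximal b -> maximal b' -> sim Q 0 a1 b -> sim Q 0 a2 b' ->
    exists (I : Type) (px py : I -> world L),
    [/\ valid L (@fork_le I),
        forall i, [/\ wle x (px i), wle y (py i), maximal (px i), maximal (py i)
                    & sim Q 0 (px i) (py i)],
        forall u, wle x u -> maximal u -> wle u x \/ exists i, wle u (px i)
      & forall v, wle y v -> maximal v -> wle v y \/ exists i, wle v (py i)].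
  move=> c yb yb' mb mb' s1 s2.
  exists bool, (fun i : bool => if i then a1 else a2), (fun i : bool => if i then b else b').
  split=> //; first by case.
  - by move=> u xu mu; right; have [h|h] := ca u xu mu; [exists true|exists false].
  - by move=> v yv mv; right; have [h|h] := c v yv mv; [exists true|exists false].
case: matching => -[s1 s2]; first exact: (cover b1 b2).
by apply: (cover b2 b1) => // m ym mm; have [] := cb m ym mm; [right|left].
Qed.

End DepthTwo.

(** * The equivalence *)

Section Branching.
Variables (L : form -> Prop) (hL : intermediate_logic L) (cip : CIP L).

Lemma ulip_of_branching (B : finType) (hB : forall s t : B, s = t) :
  (B -> forall w : world L, exists t, forall u, wle w u -> wle u t) ->
  fvalid L (top_frame hB fork) -> fvalid L (top_frame hB three_chain) -> ULIP L.
Proof.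
move=> can_top vf vc.
have gp (X : frame) (x0 : X) := @good_plus L hL cip B hB X x0 vf vc.
(* Putting a root below two points makes the fork good, and [step_fork] trades its inner root for a
   third leaf. *)
have g2 : good L hB two_points.
  by apply: step_fork => //; apply: gp => //; exact: (inl tt).
apply: (ulip_of_all_valid hL (B0 := B)) => // K le le_refl le_trans le_top.
apply: (good_valid (hB := hB)) => //.
- by move=> X Y x0 y0; apply: good_sum.
- by move=> X x0 gX; apply: gp => //; apply: plus_of_good.
Qed.

Lemma four_chain : fvalid L three_chain -> fvalid L (top_frame unit_irrelevant three_chain).
Proof.
move=> v3.
have /top_void : fvalid L (top_frame void_irrelevant (plus_frame three_chain)).
  by apply: step_plus => //; [exact: None|apply/top_void|apply/top_void].
apply: (@valid_pmorph L (plus_frame three_chain) (top_frame unit_irrelevant three_chain) _ _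
  (fun a : plus_frame three_chain => match a with
  | None => inl None | Some None => inl (Some None)
  | Some (Some None) => inl (Some (Some tt)) | Some (Some (Some _)) => inr tt
  end : top_frame unit_irrelevant three_chain)).
- by case=> [[[[]|]|]|] [[[[]|]|]|].
- case=> [[[[]|]|]|] [[[[]|]|]|[]] //= _;
    by [exists None|exists (Some None)|exists (Some (Some None))|exists (Some (Some (Some tt)))].
- case=> [[[[]|]|]|[]];
    by [exists None|exists (Some None)|exists (Some (Some None))|exists (Some (Some (Some tt)))].
Qed.

Lemma ulip_of_cip : ULIP L.
Proof.
have [v3|n3] := pselect (fvalid L three_chain); last first.
  by apply: ulip_of_depth_two => //; apply: no_three_chain.
have [v2|n2] := pselect (fvalid L fork).
  by apply: (@ulip_of_branching void void_irrelevant) => //; apply/top_void.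
have wem := no_fork hL n2.
have [vd|nd] := pselect (fvalid L diamond).
  apply: (@ulip_of_branching unit unit_irrelevant) => //; last exact: four_chain.
  by move=> _; apply: wem_top.
apply: ulip_of_linear => //; first exact: no_diamond.
exact: ord_valid.
Qed.

End Branching.

(** * Elementary implications between the four properties *)

Lemma ulip_lip L : ULIP L -> LIP L.
Proof.
(* Forbidding the signed variables of [A] that are missing from [B] leaves the common ones and
   excludes nothing from [B]. *)
move=> h A B hAB; have [C [h1 h2 h3]] := h A (fun o => svars o A `\` svars o B)%fset.
exists C; split=> //.
  move=> o; apply: fsubset_trans (h2 o) _; apply/fsubsetP => p.
  by rewrite !inE negb_and negbK => /andP[/orP[->|/negP] h'] //; rewrite h'.
apply: h3 => // o; apply/fsetP => p; rewrite !inE.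
by case: (p \in svars o B); rewrite ?andbF.
Qed.

Lemma lip_cip L : LIP L -> CIP L.
Proof.
move=> h A B /h [C [hC h1 h2]]; exists C; split=> //.
apply/fsubsetP => p /vars_svars [o /(fsubsetP (hC o))].
by rewrite !inE => /andP[/svars_vars -> /svars_vars ->].
Qed.

Lemma ulip_uip L : ULIP L -> UIP L.
Proof.
move=> h A P; have [C [h1 h2 h3]] := h A (fun _ => P); exists C; split=> //.
  apply/fsubsetP => p /vars_svars [o /(fsubsetP (h2 o))].
  by rewrite !inE => /andP[-> /svars_vars].
move=> B hAB hB; apply: h3 => // o; apply/fsetP => p; rewrite !inE.
apply/negbTE/negP => /andP[/svars_vars hp hP].
by have := in_fset0 p; rewrite -hB in_fsetI hp hP.
Qed.

Lemma uip_cip L : UIP L -> CIP L.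
Proof.
move=> h A B hAB; have [C [h1 h2 h3]] := h A (vars A `\` vars B)%fset.
exists C; split=> //.
  apply: fsubset_trans h2 _; apply/fsubsetP => p.
  by rewrite !inE negb_and negbK => /andP[/orP[->|/negP] h'] //; rewrite h'.
apply: h3 => //; apply/fsetP => p; rewrite !inE.
by case: (p \in vars B); rewrite ?andbF.
Qed.

Theorem theorem10p1 (L : form -> Prop)
  (hL : intermediate_logic L) (hcons : consistent L) :
  [<-> CIP L; UIP L; LIP L; ULIP L].
Proof.
tfae.
- by move=> cip; apply/ulip_uip/ulip_of_cip.
- by move=> /uip_cip cip; apply/ulip_lip/ulip_of_cip.
- by move=> /lip_cip cip; apply: ulip_of_cip.
- by move=> /ulip_lip /lip_cip.
Qed.
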